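(* For integers $a,b,c\ge 1$ with $b$ odd, let $$F_{a,b,c}(z)=\frac{\eta(24az)^a\,\eta(24acz)^{b-a}}{\eta(24z)}.$$ Then the following are true: (1) If $b=3$ and $a\in\{1,2,3\}$, then $F_{a,b,c}(z)$ is lacunary for all integers $c\ge 1$. (2) If $b=5$ and $a\in\{1,2\}$, then $F_{a,b,c}(z)$ is lacunary for all integers $c\ge 1$.
   Context: Here $q=e^{2\pi i z}$ with $\operatorname{Im}(z)>0$, and $\eta(z)=q^{1/24}\prod_{n=1}^{\infty}(1-q^n)$ is the Dedekind $\eta$-function. Thus $$F_{a,b,c}(z)=q^{r}\prod_{n=1}^{\infty}\frac{(1-q^{24an})^a(1-q^{24acn})^{b-a}}{1-q^{24n}},\qquad r=abc+a^2-a^2c-1.$$ A series $\sum_{n\ge 0}a(n)q^n$ is called lacunary if $$\lim_{x\to\infty}\frac{\#\{0\le n<x: a(n)=0\}}{x}=1.$$ Lacunarity of $F_{a,b,c}(z)$ refers to its expansion in powers of $q$. *)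

(* Defs.v *)
From HB Require Import structures.
From mathcomp Require Import all_boot all_order all_algebra.
From mathcomp Require Import complex finmap.
From mathcomp Require Import all_classical all_reals all_analysis.
Set Implicit Arguments.
Unset Strict Implicit.
Unset Printing Implicit Defensive.
Import Order.TTheory GRing.Theory Num.Theory.
Import numFieldNormedType.Exports.
Local Open Scope classical_set_scope.
Local Open Scope complex_scope.
Local Open Scope ring_scope.

(* R[i] is the field of complex numbers over R; its alias R[i]^o is the one
   that carries the topology, given by the modulus. *)

Definition cexp (R : realType) (w : R[i]) : R[i] :=
  (expR (complex.Re w) * cos (complex.Im w)) +i*
  (expR (complex.Re w) * sin (complex.Im w)).

(* q = e^(2 pi i z); the fractional power q^(1/24) is nome (z / 24) *)
Definition nome (R : realType) (z : R[i]) : R[i] :=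
  cexp ((2 * pi)%:C * 'i%C * z).

Definition dedekind_eta (R : realType) (z : R[i]) : R[i] :=
  nome (z / 24%:R) *
  lim ((\prod_(1 <= n < N.+1) (1 - nome z ^+ n) : R[i]^o) @[N --> \oo]).

(* The exponent b - a is an integer, possibly negative. *)
Definition etaF (R : realType) (a b c : nat) (z : R[i]) : R[i] :=
  dedekind_eta ((24 * a)%:R * z) ^+ a *
  dedekind_eta ((24 * a * c)%:R * z) ^ (b%:Z - a%:Z) /
  dedekind_eta (24%:R * z).

Definition q_expansion (R : realType) (f : R[i] -> R[i]) (u : nat -> R[i]) :=
  forall z : R[i], 0 < complex.Im z ->
    series (fun n => u n * nome z ^+ n : R[i]^o) @ \oo --> (f z : R[i]^o).

Definition lacunary_series (R : realType) (u : nat -> R[i]) :=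
  (#|` fset_set [set n : nat | n%:R < x /\ u n = 0]|%:R / x : R)
    @[x --> +oo] --> (1 : R).

(* As z runs over the upper half-plane, q runs over the punctured unit disc, so
   the coefficient sequence u is unique when it exists. *)
Definition lacunary_in_q (R : realType) (f : R[i] -> R[i]) :=
  exists u : nat -> R[i], q_expansion f u /\ lacunary_series u.

(* Main.v *)
Require Import Defs.
From mathcomp Require Import all_boot all_order all_algebra.
From mathcomp Require Import all_classical all_reals all_analysis.
From mathcomp Require Import complex finmap.
From mathcomp Require Import zify ring lra.
Set Implicit Arguments.
Unset Strict Implicit.
Unset Printing Implicit Defensive.
Import Order.TTheory GRing.Theory Num.Theory.
Import numFieldNormedType.Exports Normc.

(** Write w = q^24. Up to the factor q^r the eta quotient is the power series

      G(w) = prod (1 - w^(an))^a (1 - w^(acn))^(b-a) / (1 - w^n),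

    which is a product of two classical theta series in the first four of the
    five cases and a theta series in two variables in the last one, so that the
    exponents of the eta quotient are values of a binary quadratic form:
    - (a, b) = (1, 3) : prod (1 - w^(cn))^2, a square of Euler's pentagonal
      series, with exponents c (x^2 + y^2) in q;
    - (1, 5) : prod (1 - w^(cn))^4, Euler's series times Jacobi's series for the
      cube, with exponents c (x^2 + 3 y^2);
    - (2, 3) and (2, 5) : Gauss's series prod (1 - w^(2n))^2 / (1 - w^n) times
      Euler's, respectively Jacobi's, series in w^(2c), with exponents
      3 x^2 + 2 c y^2, respectively 3 x^2 + 6 c y^2;
    - (3, 3) : prod (1 - w^(3n))^3 / (1 - w^n), the generating series of 3-cores,
      with exponents 2 (x^2 + 3 y^2).
    After multiplication by A, a value A x^2 + B y^2 becomes a value of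
    x^2 + D y^2 with D = A B, so lacunarity follows once the values of
    x^2 + D y^2 have density zero.

    Density zero (values_density_zero). The total number of pairs (u, v) with
    u^2 + D v^2 <= x is O(x). But a value n with many prime factors has many
    representations: if omega(n) large primes of a given set divide n exactly
    once, each of the 2^omega(n) choices of signs for the roots of t^2 = - D
    modulo these primes gives, by Thue's pigeonhole argument, a pair with
    u^2 + D v^2 = k n and 1 <= k <= D + 1 (many_representations). So the number
    of values below x is at most l sum_{n < x} 2^(- omega(n)) + O(x) / l for
    each l > 0, and the mean of 2^(- omega(n)) over n is as small as we like
    because the sum of the reciprocals of the primes diverges.

    Theta identities. They all come from the q-binomial theorem: those of Euler,
    Gauss and Jacobi through the finite form of Jacobi's triple product
    (finite_jacobi_triple_product), the one for 3-cores by comparing two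
    expansions of prod_{i < 6n} (1 + z X^i) (core_identity). After
    multiplication by prod_{i <= N} (1 - X^i) each Gauss binomial coefficient
    near the middle is 1 modulo a high power of X, and the supports of the
    series can be read off.

    Passage to analysis. G is represented by integer polynomials P_N whose
    coefficients stabilise and whose sums of absolute values at r are bounded
    in N for each r < 1. Then P_N(w) and the power series of the stable
    coefficients have the same limit for |w| < 1 (coherent_family_cvg), which
    turns congruences between polynomials into identities between the analytic
    functions, including the non-vanishing of prod (1 - w^n). *)

(** * The reciprocals of the primes *)

Section SmoothNumbers.
Local Open Scope nat_scope.

(** The parities of the exponents give the squarefree part, a choice among
    2^(P+1) products, and their halves give the square. *)
Lemma smooth_square_decomposition P n : 0 < n ->
  (forall p, prime p -> p %| n -> p <= P) ->
  exists (f : {ffun 'I_P.+1 -> bool}) m,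
    n = (\prod_(p < P.+1) p ^ f p) * m ^ 2.
Proof.
move=> n0 smooth.
have -> : n = \prod_(p < P.+1) p ^ logn p n.
  rewrite -{1}(partnT n0) (widen_partn predT (leq_maxl n P)).
  rewrite (big_cat_nat (n := P.+1)) //=; last by rewrite ltnS leq_maxr.
  rewrite [X in _ * X]big1_seq ?muln1 ?big_mkord // => p.
  rewrite mem_index_iota => /andP[_ /andP[Pp _]].
  have [|] := boolP (p \in primes n); last by rewrite -logn_gt0 lt0n negbK => /eqP->.
  by rewrite mem_primes => /and3P[pp _ /(smooth p pp)]; rewrite leqNgt Pp.
exists [ffun p : 'I_P.+1 => odd (logn p n)], (\prod_(p < P.+1) p ^ (logn p n)./2).
have -> : forall x, x ^ 2 = x * x by [].
rewrite -big_split -big_split; apply: eq_bigr => p _ /=.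
by rewrite ffunE -!expnD -{1}[logn p n]odd_double_half -addnn.
Qed.

(** Counting these decompositions shows that numbers without prime factor above
    P are rare: below K^2 only O(K) of them occur. *)
Lemma smooth_count P K :
  count (fun n => (0 < n) && [forall p : 'I_n.+1, (prime p && (p %| n)) ==> (p <= P)])
    (iota 0 (K ^ 2)) <= 2 ^ P.+1 * K.
Proof.
set sm := (X in count X _).
have -> : 2 ^ P.+1 * K = #|{: {ffun 'I_P.+1 -> bool} * 'I_K}|.
  by rewrite card_prod card_ffun card_bool !card_ord.
rewrite -size_filter cardT.
rewrite -(size_map (fun z : {ffun 'I_P.+1 -> bool} * 'I_K =>
   (\prod_(p < P.+1) p ^ z.1 p) * z.2 ^ 2)).
apply: uniq_leq_size; first by rewrite filter_uniq ?iota_uniq.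
move=> n; rewrite mem_filter mem_iota add0n => /andP[/andP[n0 /forallP s] nK].
have [|f [m nE]] := @smooth_square_decomposition P n n0.
  move=> p pp pn; have pl : p < n.+1 by rewrite ltnS dvdn_leq.
  by have /implyP := s (Ordinal pl); apply; rewrite pp.
have mK : m < K.
  rewrite -(@ltn_exp2r m K 2) //; apply: leq_ltn_trans nK; rewrite nE leq_pmull //.
  by move: n0; rewrite nE muln_gt0 => /andP[].
by apply/mapP; exists (f, Ordinal mK); rewrite ?mem_enum.
Qed.
End SmoothNumbers.

Section Multiples.
Local Open Scope nat_scope.

Definition ceil_div N d := (N + d.-1) %/ d.

Lemma ceil_div_bounds N d : 0 < d -> N <= ceil_div N d * d <= N + d.-1.
Proof. by rewrite /ceil_div => d0; lia. Qed.

Lemma sum_multiples (V : nmodType) (f : nat -> V) d N : 0 < d ->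
  (\sum_(0 <= n < N | (d %| n)%N) f n = \sum_(0 <= m < ceil_div N d) f (d * m)%N)%R.
Proof.
move=> d0; elim: N => [|N IH].
  by rewrite /ceil_div add0n divn_small ?prednK // !big_nil.
rewrite big_mkcond big_nat_recr //= -big_mkcond /= IH.
have -> : ceil_div N.+1 d = (d %| N) + ceil_div N d.
  rewrite /ceil_div addSn divnS // -addnS prednK //.
  by rewrite dvdn_addl.
case: ifPn => [/dvdnP[k ->]|_]; last by rewrite GRing.addr0 add0n.
rewrite add1n big_nat_recr //=; congr (_ + f _)%R.
by rewrite /ceil_div divnMDl // divn_small ?addn0 1?mulnC // prednK.
Qed.
End Multiples.

Section PrimeReciprocals.
Local Open Scope ring_scope.
Variable R : archiRealFieldType.

Lemma ler_ceil_div N d : (0 < d)%N ->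
  N%:R / d%:R <= (ceil_div N d)%:R :> R /\ (ceil_div N d)%:R <= N%:R / d%:R + 1 :> R.
Proof.
move=> d0; have /andP[l u] := ceil_div_bounds N d0.
have dp : 0 < d%:R :> R by rewrite ltr0n.
split; first by rewrite ler_pdivrMr // -natrM ler_nat.
rewrite -(ler_pM2r dp) mulrDl mulfVK ?gt_eqF // mul1r -natrM -natrD ler_nat.
by lia.
Qed.

Lemma count_positive_multiples_le d N : (0 < d)%N ->
  (count (fun n => (0 < n)%N && (d %| n)%N) (iota 0 N))%:R <= N%:R / d%:R :> R.
Proof.
move=> d0; have [_ u] := ler_ceil_div N d0.
suff : (count (fun n => (0 < n)%N && (d %| n)%N) (iota 0 N) <= (ceil_div N d).-1)%N.
  case: (ceil_div N d) u => [|k] u; rewrite -(ler_nat R).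
    by move=> /le_trans; apply; rewrite divr_ge0.
  by move=> /le_trans; apply; move: u; rewrite -natr1 lerD2r.
rewrite -sum1_count -[X in iota 0 X]subn0 -/(index_iota 0 N).
rewrite (eq_bigl (fun n => (d %| n)%N && (0 < n)%N)); last by move=> n; rewrite andbC.
rewrite big_mkcondr.
have -> : (\sum_(0 <= n < N | d %| n) (if 0 < n then 1 else 0) =
   \sum_(0 <= m < ceil_div N d) (if 0 < d * m then 1 else 0))%N.
  exact: (sum_multiples (fun n => if (0 < n)%N then 1%N else 0%N)).
case: (ceil_div N d) => [|k]; first by rewrite big_nil.
rewrite big_nat_recl //= muln0 /= add0n -[X in (_ <= X)%N]muln1 -[X in (_ <= X * _)%N]subn0.
rewrite -sum_nat_const_nat; apply: leq_sum => i _; by case: ifP.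
Qed.

(** Erdos's argument: if the primes above P had reciprocals summing to at most
    1/2, then at most half of the integers below N would have a prime factor
    above P, and the remaining ones are too few to fill the other half. *)
Lemma prime_reciprocals_tail P :
  exists M, 1 / 2 < \sum_(p <- index_iota P.+1 M | prime p) p%:R^-1 :> R.
Proof.
(* With K = 8 * 2^(P+1) the smooth numbers below K^2 are at most K^2 / 8. *)
pose K := (2 ^ P.+4)%N; pose N := (K ^ 2)%N; exists N.
rewrite ltNge; apply/negP => small.
pose sm n := (0 < n)%N && [forall p : 'I_n.+1, (prime p && (p %| n)) ==> (p <= P)]%N.
pose big n := has (fun p => prime p && (0 < n)%N && (p %| n)%N) (index_iota P.+1 N).
have cover : (N.-1 <= count sm (iota 0 N) + count big (iota 0 N))%N.
  rewrite -count_predUI; apply: leq_trans (leq_addr _ _).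
  have N0 : (0 < N)%N by rewrite /N !expn_gt0.
  rewrite -(prednK N0) /= -[X in (X <= _)%N](size_iota 1).
  apply: leq_trans (leq_addl _ _).
  apply: eq_leq; symmetry; apply/eqP; rewrite -all_count; apply/allP => n.
  rewrite mem_iota => /andP[n0 nN] /=.
  rewrite /sm n0 /=; case: (boolP [forall _, _]) => //= /forallPn[[p pn]] /=.
  rewrite negb_imply -ltnNge => /andP[/andP[pp pdn] Pp].
  apply/hasP; exists p; last by rewrite pp n0.
  by rewrite mem_index_iota Pp /=; move: pn nN; lia.
have cbig : (count big (iota 0 N))%:R <= N%:R / 2 :> R.
  have : (count big (iota 0 N) <= \sum_(p <- index_iota P.+1 N | prime p)
     count (fun n => (0 < n) && (p %| n)) (iota 0 N))%N.
    rewrite /big; elim: (index_iota P.+1 N) => [|p s IH].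
      by rewrite big_nil (@eq_count _ _ pred0) ?count_pred0.
    rewrite big_cons /=.
    have -> : count (fun n => prime p && (0 < n)%N && (p %| n)%N
        || has (fun p0 => prime p0 && (0 < n)%N && (p0 %| n)%N) s) (iota 0 N) =
      count (predU (fun n => prime p && (0 < n)%N && (p %| n)%N)
         (fun n => has (fun p0 => prime p0 && (0 < n)%N && (p0 %| n)%N) s)) (iota 0 N) by [].
    have := count_predUI (fun n => prime p && (0 < n)%N && (p %| n)%N)
         (fun n => has (fun p0 => prime p0 && (0 < n)%N && (p0 %| n)%N) s) (iota 0 N).
    case: (prime p) IH => /=; first by lia.
    by rewrite count_pred0; lia.
  rewrite -(ler_nat R) => /le_trans; apply.
  rewrite natr_sum.
  apply: le_trans (_ : \sum_(p <- index_iota P.+1 N | prime p) N%:R / p%:R <= _).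
    by apply: ler_sum => p pp; apply: count_positive_multiples_le; exact: prime_gt0.
  rewrite -mulr_sumr; apply: ler_wpM2l => //.
  by rewrite -[2^-1]mul1r.
have csm := smooth_count P K; rewrite -/sm -/N in csm.
have : (4 * count sm (iota 0 N) <= N)%N.
  have KE : (K = 8 * 2 ^ P.+1)%N by rewrite /K !expnS; lia.
  rewrite {2}/N -mulnn {1}KE -mulnA; move: csm.
  move: (count _ _) (2 ^ P.+1 * K)%N => u v; lia.
have NR : N%:R > 4 :> R.
  rewrite ltr_nat /N /K -expnM; apply: (@leq_trans (2 ^ (4 * 2))) => //.
  by rewrite leq_exp2l // leq_mul.
move: cover; rewrite -!(ler_nat R) natrD natrM => c1 c2.
have : N%:R = (N.-1)%:R + 1 :> R by rewrite natr1 prednK // /N !expn_gt0.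
by move: c1 c2 cbig NR; lra.
Qed.

(** Each application of the previous lemma, beyond all primes used so far,
    contributes another 1/2. *)
Lemma prime_reciprocals_unbounded P (A : R) :
  exists S : seq nat, [/\ uniq S, forall p, p \in S -> prime p /\ (P < p)%N &
     A <= \sum_(p <- S) p%:R^-1].
Proof.
suff H : forall k : nat, exists S : seq nat, [/\ uniq S,
    forall p, p \in S -> prime p /\ (P < p)%N & (k%:R / 2) <= \sum_(p <- S) p%:R^-1 :> R].
  have [S [uS pS lS]] := H (Num.bound `|2 * A|); exists S; split => //.
  apply: le_trans lS; have := archi_boundP (normr_ge0 (2 * A)); have := ler_norm (2 * A).
  by lra.
elim=> [|k [S [uS pS lS]]]; first by exists [::]; split => //; rewrite big_nil mul0r.
pose P' := maxn P (\max_(p <- S) p).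
have [M hM] := prime_reciprocals_tail P'.
exists (S ++ [seq p <- index_iota P'.+1 M | prime p]); split.
- rewrite cat_uniq uS filter_uniq ?iota_uniq // andbT /=.
  apply/hasPn => p; rewrite mem_filter mem_index_iota => /andP[_ /andP[Pp _]].
  apply/negP => pS'; move: Pp; rewrite ltnNge => /negP; apply.
  by rewrite leq_max; apply/orP; right; exact: (@leq_bigmax_seq _ S xpredT id).
- move=> p; rewrite mem_cat => /orP[/pS //|].
  rewrite mem_filter mem_index_iota => /andP[pp /andP[Pp _]]; split=> //.
  by apply: leq_ltn_trans Pp; rewrite leq_maxl.
- rewrite big_cat big_filter /= -natr1; lra.
Qed.
End PrimeReciprocals.

(** * The mean of 2^(- omega) for exact prime divisors *)

Section Weights.
Local Open Scope ring_scope.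
Variable R : archiRealFieldType.

Definition exactly_divides p n := (p %| n)%N && ~~ (p ^ 2 %| n)%N.

(** Two to the power minus the number of primes of S dividing n exactly once. *)
Definition weight (S : seq nat) n : R :=
  \prod_(p <- S) (if exactly_divides p n then 1 / 2 else 1).

(** A prime p divides exactly the proportion 1/p - 1/p^2 of the integers exactly
    once, and it halves their weight. *)
Definition mean_weight (S : seq nat) : R :=
  \prod_(p <- S) (1 - (1 / 2) * (p%:R^-1 - (p ^ 2)%:R^-1)).

Lemma weightE S n : weight S n = (2 ^+ count (exactly_divides ^~ n) S)^-1.
Proof.
rewrite /weight; elim: S => [|p S IH]; first by rewrite big_nil invr1.
rewrite big_cons IH /=; case: (exactly_divides p n) => /=; last by rewrite mul1r.
by rewrite add1n exprS invfM mul1r.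
Qed.

Lemma weight_mul_coprime S d n : all (coprime d) S -> weight S (d * n)%N = weight S n.
Proof.
move=> /allP cop; rewrite /weight; apply: eq_big_seq => p pS.
have cpd : coprime p d by rewrite coprime_sym cop.
by rewrite /exactly_divides !Gauss_dvdr ?coprimeXl.
Qed.

(** Induction on S. Among the n < N, the multiples of p (of p^2) are the p m
    (the p^2 m) with m below the ceiling of N/p (of N/p^2), and their weight for
    the other primes is that of m; so one more prime changes the sum only
    through earlier sums at N/p and N/p^2, and the bound on the error stays
    independent of N. *)
Lemma sum_weight S : uniq S -> (forall p, p \in S -> prime p) ->
  exists K : R, forall N,
   `|\sum_(0 <= n < N) weight S n - mean_weight S * N%:R| <= K.
Proof.
elim: S => [|p S IH] /= => [_ _|/andP[pS uS] pr].
  exists 0 => N; rewrite /mean_weight big_nil mul1r (eq_bigr (fun=> 1)).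
    by rewrite sumr_const_nat subn0 subrr normr0.
  by move=> n _; rewrite /weight big_nil.
have pp : prime p by apply: pr; rewrite mem_head.
have [|K hK] := IH uS; first by move=> q qS; apply: pr; rewrite inE qS orbT.
have K0 : 0 <= K by apply: le_trans (hK 0%N).
pose W N : R := \sum_(0 <= n < N) weight S n.
pose m := mean_weight S.
have cop : all (coprime p) S.
  apply/allP => q qS; rewrite prime_coprime // dvdn_prime2 //; last first.
    by apply: pr; rewrite inE qS orbT.
  by apply: contra pS => /eqP->.
have p0 := prime_gt0 pp; have p20 : (0 < p ^ 2)%N by rewrite expn_gt0 p0.
have step N : \sum_(0 <= n < N) weight (p :: S) n =
    W N - (1 / 2) * (W (ceil_div N p) - W (ceil_div N (p ^ 2))).
  have mulE d : (0 < d)%N -> all (coprime d) S ->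
      W (ceil_div N d) = \sum_(0 <= n < N) (if (d %| n)%N then weight S n else 0).
    move=> d0 cd; rewrite -big_mkcond sum_multiples //.
    by apply: eq_bigr => i _; rewrite weight_mul_coprime.
  rewrite (mulE p) // (mulE (p ^ 2)%N) //; last first.
    by apply/allP => q qS; rewrite coprimeXl // (allP cop).
  rewrite -sumrB mulr_sumr -sumrB; apply: eq_bigr => n _.
  rewrite {1}/weight big_cons -/(weight S n) /exactly_divides.
  have [p2n|] := boolP (p ^ 2 %| n)%N.
    have -> : (p %| n)%N by apply: dvdn_trans p2n; rewrite dvdn_exp.
    by rewrite /= subrr mulr0 subr0 mul1r.
  by case: (p %| n)%N => _ /=; lra.
have close d : (0 < d)%N -> forall N, `|W (ceil_div N d) - m * (N%:R / d%:R)| <= K + `|m|.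
  move=> d0 N; have [l u] := @ler_ceil_div R N d d0.
  apply: le_trans (ler_distD (m * (ceil_div N d)%:R) _ _) _; apply: lerD; first exact: hK.
  by rewrite -mulrBr normrM ler_piMr // ger0_norm; lra.
exists (K + (K + `|m|) + (K + `|m|)) => N; rewrite step.
rewrite /mean_weight big_cons -/(mean_weight S) -/m.
have h1 := hK N; rewrite -/(W N) -/m in h1.
have h2 := close p p0 N; have h3 := close (p ^ 2)%N p20 N.
have -> : W N - 1 / 2 * (W (ceil_div N p) - W (ceil_div N (p ^ 2))) -
   (1 - 1 / 2 * (p%:R^-1 - (p ^ 2)%:R^-1)) * m * N%:R =
   (W N - m * N%:R) - 1 / 2 * (W (ceil_div N p) - m * (N%:R / p%:R))
   + 1 / 2 * (W (ceil_div N (p ^ 2)) - m * (N%:R / (p ^ 2)%:R)) by ring.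
move: h1 h2 h3; rewrite !ler_norml => /andP[? ?] /andP[? ?] /andP[? ?].
by apply/andP; split; lra.
Qed.

(** An exponential-free form of prod (1 - x_i) <= exp (- sum x_i), which also
    tends to zero when the sum diverges. *)
Lemma prod_one_minus_le (I : eqType) (S : seq I) (x : I -> R) :
  (forall i, i \in S -> 0 <= x i <= 1) ->
  0 <= \prod_(i <- S) (1 - x i) /\
  \prod_(i <- S) (1 - x i) * (1 + \sum_(i <- S) x i) <= 1.
Proof.
elim: S => [|i S IH] h; first by rewrite !big_nil addr0 mulr1; split.
have /andP[x0 x1] : 0 <= x i <= 1 by apply: h; rewrite mem_head.
have [|P0 PS] := IH; first by move=> j jS; apply: h; rewrite inE jS orbT.
have s0 : 0 <= \sum_(j <- S) x j.
  rewrite big_seq sumr_ge0 // => j jS.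
  by have /andP[] : 0 <= x j <= 1 by apply: h; rewrite inE jS orbT.
rewrite !big_cons; split; first by rewrite mulr_ge0 // subr_ge0.
move: P0 PS s0; move: (\prod_(_ <- _) _) (\sum_(_ <- _) _) => P s P0 PS s0.
apply: le_trans PS; rewrite -subr_ge0.
have -> : P * (1 + s) - (1 - x i) * P * (1 + (x i + s)) = P * (x i * (x i + s)) by ring.
by rewrite !mulr_ge0 // addr_ge0.
Qed.

Lemma mean_weight_small P (d : R) : 0 < d ->
  exists S : seq nat, [/\ uniq S, forall p, p \in S -> prime p /\ (P < p)%N &
     mean_weight S < d].
Proof.
move=> d0; have [S [uS pS hS]] := @prime_reciprocals_unbounded R P (4 / d).
exists S; split => //.
pose x p : R := (1 / 2) * (p%:R^-1 - (p ^ 2)%:R^-1).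
have xb p : p \in S -> p%:R^-1 / 4 <= x p <= 1.
  move=> /pS[/prime_gt1 p1 _]; rewrite /x natrX -exprVn.
  have : 0 < p%:R^-1 :> R by rewrite invr_gt0 ltr0n ltnW.
  have : p%:R^-1 <= 2^-1 :> R by rewrite lef_pV2 ?posrE ?ltr0n ?ler_nat // ltnW.
  by move: (p%:R^-1) => y; nra.
have [|P0 P1] := @prod_one_minus_le _ S x.
  move=> p pS'; have /andP[l ->] := xb p pS'; rewrite andbT.
  by apply: le_trans l; rewrite divr_ge0 ?invr_ge0.
have : d^-1 <= \sum_(p <- S) x p.
  apply: le_trans (_ : \sum_(p <- S) (p%:R^-1 / 4) <= _).
    by rewrite -mulr_suml; move: hS; lra.
  rewrite [leLHS]big_seq [leRHS]big_seq; apply: ler_sum => p pS'.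
  by have /andP[] := xb p pS'.
move=> h.
have di : 0 < d^-1 by rewrite invr_gt0.
rewrite -[d]invrK -[ltRHS]mul1r ltr_pdivlMr //.
have {}P0 : 0 <= mean_weight S := P0.
have {}P1 : mean_weight S * (1 + \sum_(p <- S) x p) <= 1 := P1.
move: (mean_weight S) (\sum_(p <- S) x p) h P0 P1 => m s h; rewrite le_eqVlt.
case/orP => [/eqP<- _|P0 P1]; first by rewrite mul0r ltr01.
by have := ler_wpM2l (ltW P0) h; lra.
Qed.
End Weights.

(** * Many representations by a binary form *)

Section Thue.
Local Open Scope nat_scope.

Lemma nat_sqrt_exists n : exists k, k ^ 2 <= n < k.+1 ^ 2.
Proof.
elim: n => [|n [k /andP[kn nk]]]; first by exists 0.
have [h|h] := ltnP n.+1 (k.+1 ^ 2); first by exists k; rewrite h (leq_trans kn).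
by exists k.+1; rewrite h; nia.
Qed.

Definition residue M (a : int) : 'I_M.+1 := inord `|(a %% M.+1%:Z)%Z|.

Lemma residue_eq M a b : residue M a = residue M b -> (M.+1%:Z %| (a - b)%R)%Z.
Proof.
have lt c : `|(c %% M.+1%:Z)%Z| < M.+1.
  by have := @ltz_pmod c M.+1 isT; have := @modz_ge0 c M.+1 isT; lia.
move=> /(congr1 val); rewrite /= !inordK // => e.
rewrite -eqz_mod_dvd; apply/eqP.
by have := @modz_ge0 a M.+1 isT; have := @modz_ge0 b M.+1 isT; lia.
Qed.

Lemma dvdz_opp d m : (d %| (- m)%R)%Z = (d %| m)%Z.
Proof. by rewrite !dvdzE abszN. Qed.

(** A pair (u, v) of integers matters only up to a global sign, so u can be kept
    natural and only v carries a sign. *)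
Definition signed (s : bool) (v : nat) : int := if s then (- v%:Z)%R else v%:Z%R.

(** Pigeonhole: there are more than M Q pairs of naturals whose squares are
    at most M Q, and two of them agree in both residues; their difference is (u, v). *)
Lemma thue_pair M Q (x y : int) : 0 < M -> 0 < Q ->
  exists (u v : nat) (s : bool), [/\ 0 < u + v, u ^ 2 <= M * Q, v ^ 2 <= M * Q,
   (M%:Z %| (u%:Z * y - signed s v * x)%R)%Z & (Q%:Z %| (u%:Z * y + signed s v * x)%R)%Z].
Proof.
case: M => // M _; case: Q => // Q _.
have [k /andP[k1 k2]] := nat_sqrt_exists (M.+1 * Q.+1).
pose f (z : 'I_k.+1 * 'I_k.+1) : 'I_M.+1 * 'I_Q.+1 :=
  (residue M (z.1%:Z * y - z.2%:Z * x)%R, residue Q (z.1%:Z * y + z.2%:Z * x)%R).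
have /injectivePn[[u1 v1] [[u2 v2] neq]] : ~~ injectiveb f.
  apply/negP => /injectiveP /leq_card.
  by rewrite !card_prod !card_ord leqNgt mulnn k2.
move=> [/residue_eq /= eM /residue_eq /= eQ].
wlog u12 : u1 v1 u2 v2 neq eM eQ / u2 <= u1.
  move=> W; have [|/ltnW] := leqP u2 u1; first exact: (W u1 v1 u2 v2).
  apply: (W u2 v2 u1 v1); first by rewrite eq_sym.
    by move: eM; rewrite -dvdz_opp; congr (is_true (_ %| _)%Z); ring.
  by move: eQ; rewrite -dvdz_opp; congr (is_true (_ %| _)%Z); ring.
have ku1 := ltn_ord u1; have kv1 := ltn_ord v1; have kv2 := ltn_ord v2.
exists (u1 - u2), (if v2 <= v1 then v1 - v2 else v2 - v1), (~~ (v2 <= v1)).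
have sE : signed (~~ (v2 <= v1)) (if v2 <= v1 then v1 - v2 else v2 - v1) = (v1%:Z - v2%:Z)%R.
  by rewrite /signed; case: leqP => /= ?; lia.
split.
- rewrite lt0n; apply: contra neq; rewrite addn_eq0 => /andP[a b].
  apply/eqP; congr pair; apply: val_inj => /=.
    by apply/eqP; rewrite eqn_leq u12 andbT -subn_eq0.
  by move: b => /eqP; case: (leqP v2 v1) => ? ?; lia.
- by apply: leq_trans k1; rewrite leq_exp2r //; lia.
- by apply: leq_trans k1; rewrite leq_exp2r //; case: (leqP v2 v1) => ?; lia.
- rewrite sE -subzn //; move: eM; congr (is_true (_ %| _)%Z); ring.
- rewrite sE -subzn //; move: eQ; congr (is_true (_ %| _)%Z); ring.
Qed.
End Thue.

Section Representations.
Local Open Scope nat_scope.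

Lemma prime_dvd_prod_primes p (S : seq nat) : prime p -> (forall q, q \in S -> prime q) ->
  (p %| \prod_(q <- S) q) = (p \in S).
Proof.
move=> pp; elim: S => [|q S IH] prS.
  by rewrite big_nil dvdn1 in_nil; case: p pp => [|[|p]].
rewrite big_cons Euclid_dvdM // inE IH; last by move=> r rS; rewrite prS // inE rS orbT.
by rewrite dvdn_prime2 // prS // mem_head.
Qed.

Lemma prod_primes_dvd n (S : seq nat) : uniq S ->
  (forall q, q \in S -> prime q /\ q %| n) -> \prod_(q <- S) q %| n.
Proof.
elim: S => [|q S IH] /=; first by rewrite big_nil dvd1n.
move=> /andP[qS uS] prS; have [pq qn] := prS q (mem_head _ _).
have h r : r \in S -> prime r /\ r %| n by move=> rS; apply: prS; rewrite inE rS orbT.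
rewrite big_cons Gauss_dvd ?qn ?IH // prime_coprime //.
by rewrite prime_dvd_prod_primes // => r /h[].
Qed.

(** Let Q be the product of the primes of S outside A, and M = n / Q. A Thue pair
    for (M, Q) has n dividing y^2 (u^2 + D v^2), because
    y^2 (u^2 + D v^2) = (u y - v x) (u y + v x) + v^2 n; and y is prime to n.
    Each p in A divides M, hence u y - v x. A p outside A divides u y + v x; were
    it also a divisor of u y - v x, it would divide u and v, so p^2 would divide
    k n, which p > D + 1 >= k excludes. *)
Lemma prescribed_signs D n x y (S : seq nat) (A : pred nat) :
  0 < D -> n = x ^ 2 + D * y ^ 2 -> coprime x y -> uniq S ->
  (forall p, p \in S -> [/\ prime p, D.+1 < p & exactly_divides p n]) ->
  exists u v s k, [/\ 0 < k <= D.+1, u ^ 2 + D * v ^ 2 = k * n &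
    forall p, p \in S -> (p%:Z %| (u%:Z * y%:Z - signed s v * x%:Z)%R)%Z = A p].
Proof.
move=> D0 nE cxy uS prS.
have n0 : 0 < n.
  rewrite nE; case: x cxy {nE} => [|x] //; case: y => //.
  by move=> y _; rewrite addn_gt0 muln_gt0 D0 orbT.
pose T := [seq p <- S | ~~ A p]; pose Q := \prod_(p <- T) p.
have prT p : p \in T -> prime p by rewrite mem_filter => /andP[_ /prS[]].
have Qn : Q %| n.
  apply: prod_primes_dvd; first by rewrite filter_uniq.
  by move=> q; rewrite mem_filter => /andP[_ /prS[? _ /andP[]]].
pose M := n %/ Q; have nMQ : M * Q = n by rewrite divnK.
have [M0 Q0] : 0 < M /\ 0 < Q by move: n0; rewrite -nMQ muln_gt0 => /andP.
have [u [v [s [uv0 un vn dM dQ]]]] := thue_pair x%:Z y%:Z M0 Q0.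
rewrite nMQ in un vn.
have cyn : coprime n y.
  rewrite coprime_sym nE addnC -[y ^ 2]mulnn mulnA /coprime gcdnMDl.
  by rewrite -/(coprime _ _) coprimeXr // coprime_sym.
have id : ((u%:Z * y%:Z - signed s v * x%:Z) * (u%:Z * y%:Z + signed s v * x%:Z)
   + v%:Z ^+ 2 * n%:Z = y%:Z ^+ 2 * (u ^ 2 + D * v ^ 2)%N%:Z)%R.
  have -> : (n%:Z = x%:Z ^+ 2 + D%:Z * y%:Z ^+ 2)%R by rewrite nE; lia.
  have -> : ((u ^ 2 + D * v ^ 2)%N%:Z = u%:Z ^+ 2 + D%:Z * v%:Z ^+ 2)%R by lia.
  by rewrite /signed; case: s {dM dQ}; ring.
have nq : n %| u ^ 2 + D * v ^ 2.
  rewrite -(@Gauss_dvdr n (y ^ 2)) ?coprimeXr //.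
  have : (n%:Z %| (y%:Z ^+ 2 * (u ^ 2 + D * v ^ 2)%N%:Z)%R)%Z.
    rewrite -id; apply: rpredD; last exact: dvdz_mull.
    by rewrite -nMQ PoszM; exact: dvdz_mul.
  by rewrite dvdzE abszM abszX !absz_nat.
move/dvdnP: nq => [k kE].
have k0 : 0 < k.
  rewrite lt0n; apply: contraTneq uv0 => k0; move: kE; rewrite k0 mul0n -leqNgt.
  move/eqP; rewrite addn_eq0 muln_eq0 !expn_eq0 /= !andbT (gtn_eqF D0) /=.
  by move=> /andP[/eqP-> /eqP->].
have kD : k <= D.+1.
  by rewrite -(leq_pmul2r n0) -kE mulSn leq_add // leq_mul2l vn orbT.
exists u, v, s, k; split; rewrite ?k0 ?kD // => p pS.
have [pp pD /andP[pn p2n]] := prS p pS.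
case: (boolP (A p)) => Ap.
  have pQ : ~~ (p %| Q).
    by rewrite prime_dvd_prod_primes // mem_filter Ap.
  have pM : p %| M by move: pn; rewrite -nMQ Euclid_dvdM // (negPf pQ) orbF.
  by apply: dvdz_trans dM; rewrite dvdzE.
apply/negP => dp.
have dp' : (p%:Z %| (u%:Z * y%:Z + signed s v * x%:Z)%R)%Z.
  apply: dvdz_trans dQ; rewrite dvdzE !absz_nat.
  by rewrite prime_dvd_prod_primes // mem_filter Ap.
have p2 : ~~ (p %| 2) by rewrite gtnNdvd // (leq_ltn_trans _ pD).
have py : ~~ (p %| y).
  apply/negP => py; have := dvdn_gcd p n y; rewrite pn py (eqP cyn) dvdn1.
  by case: eqP pp => // ->.
have px : ~~ (p %| x).
  apply: contraL pn => px; rewrite nE dvdn_addr ?dvdn_exp //.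
  by rewrite Euclid_dvdM // Euclid_dvdX // (negPf py) orbF gtnNdvd // ltnW.
have pu : p %| u.
  have : (p%:Z %| ((2 * u * y)%N%:Z)%R)%Z.
    have -> : ((2 * u * y)%N%:Z =
        ((u%:Z * y%:Z + signed s v * x%:Z) + (u%:Z * y%:Z - signed s v * x%:Z)))%R.
      by rewrite !PoszM; ring.
    by rewrite rpredD.
  by rewrite dvdzE !absz_nat !Euclid_dvdM // (negPf p2) (negPf py) orbF.
have pv : p %| v.
  have : (p%:Z %| (2 * signed s v * x%:Z)%R)%Z.
    have -> : (2 * signed s v * x%:Z =
        (u%:Z * y%:Z + signed s v * x%:Z) - (u%:Z * y%:Z - signed s v * x%:Z))%R.
      by ring.
    by rewrite rpredB.
  rewrite dvdzE !abszM !absz_nat.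
  have -> : `|signed s v| = v by rewrite /signed; case: s {dM dQ id dp dp'} => //; rewrite abszN.
  by rewrite !Euclid_dvdM // (negPf px) (negPf p2) orbF.
have : p ^ 2 %| k * n.
  rewrite -kE; apply: dvdn_add; last apply: dvdn_mull; exact: dvdn_exp2r.
have pk : coprime (p ^ 2) k.
  by rewrite coprimeXl // prime_coprime // gtnNdvd // (leq_ltn_trans kD).
by rewrite Gauss_dvdr // (negPf p2n).
Qed.

(** The multiples k n with k <= D + 1 are allowed because this is what the
    pigeonhole argument yields; it costs only a constant factor on average. *)
Definition represents D (B : nat) n : pred ('I_B * 'I_B * bool) :=
  fun z => [exists k : 'I_D.+1, z.1.1 ^ 2 + D * z.1.2 ^ 2 == k.+1 * n].

(** For a primitive representation the sets of p in S with p | u y - v x are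
    prescribed freely, so there are at least as many pairs as subsets. In general divide by
    g = gcd (x, y): a prime dividing n exactly once does not divide g, so scaling
    the pairs by g keeps these sets. *)
Lemma many_representations D n x y (S : seq nat) B :
  0 < D -> 0 < n -> n = x ^ 2 + D * y ^ 2 -> uniq S ->
  (forall p, p \in S -> prime p /\ D.+1 < p) ->
  (forall m, m ^ 2 <= D.+1 * n -> m < B) ->
  2 ^ count (exactly_divides ^~ n) S <= #|@represents D B n|.
Proof.
move=> D0 n0 nE uS prS hB.
pose g := gcdn x y.
have g0 : 0 < g.
  rewrite gcdn_gt0; move: n0; rewrite nE; case: x {nE g} => //=; case: y => //.
  by rewrite muln0.
pose x' := x %/ g; pose y' := y %/ g.
have xE : x = x' * g by rewrite divnK // dvdn_gcdl.
have yE : y = y' * g by rewrite divnK // dvdn_gcdr.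
have cxy : coprime x' y'.
  by rewrite /coprime -(eqn_pmul2r g0) mul1n muln_gcdl -xE -yE.
pose n' := x' ^ 2 + D * y' ^ 2.
have nn' : n = n' * g ^ 2 by rewrite nE xE yE /n' !expnMn mulnDl mulnA.
pose Sn := [seq p <- S | exactly_divides p n].
have prSn p : p \in Sn -> [/\ prime p, D.+1 < p, exactly_divides p n' & ~~ (p %| g)].
  rewrite mem_filter => /andP[/andP[pn p2n] /prS[pp pD]].
  have pg : ~~ (p %| g).
    by apply: contra p2n => pg; rewrite nn'; apply: dvdn_mull; exact: dvdn_exp2r.
  have cg : coprime p g by rewrite prime_coprime.
  split=> //; apply/andP; split.
    by move: pn; rewrite nn' Euclid_dvdM // Euclid_dvdX // (negPf pg) orbF.
  by apply: contra p2n => h; rewrite nn' dvdn_mulr.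
pose I := seq_sub Sn.
have uSn : uniq Sn by rewrite filter_uniq.
pose F (z : 'I_B * 'I_B * bool) : {ffun I -> bool} :=
  [ffun p : I => ((ssval p)%:Z %| (z.1.1%:Z * y'%:Z - signed z.2 z.1.2 * x'%:Z)%R)%Z].
have -> : 2 ^ count (exactly_divides ^~ n) S = #|{: {ffun I -> bool}}|.
  by rewrite card_ffun card_bool card_seq_sub // size_filter.
apply: leq_trans (leq_image_card F _).
apply/subset_leq_card/fintype.subsetP => f _.
pose A p := if insub p is Some i then f i else false.
have [p /prSn[]//|u [v [s [k [/andP[k0 kD] kE AE]]]]] :=
  @prescribed_signs D n' x' y' Sn A D0 (erefl _) cxy uSn.
have kn : (g * u) ^ 2 + D * (g * v) ^ 2 = k * n.
  by rewrite nn' mulnA -kE !expnMn mulnDl -mulnA ![g ^ 2 * _]mulnC.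
have bd m : m ^ 2 <= k * n -> m < B.
  by move=> /leq_trans-/(_ (D.+1 * n))h; apply: hB; apply: h; rewrite leq_mul2r kD orbT.
have uB : g * u < B by apply: bd; rewrite -kn leq_addr.
have vB : g * v < B.
  by apply: bd; rewrite -kn; apply: leq_trans (leq_addl _ _); rewrite leq_pmull.
apply/fintype.imageP; exists (Ordinal uB, Ordinal vB, s).
  apply/existsP; have kD' : k.-1 < D.+1 by rewrite prednK.
  by exists (Ordinal kD'); rewrite /= kn prednK.
apply/ffunP => p; rewrite ffunE /=.
have pS : ssval p \in Sn := ssvalP p.
have [pp _ _ pg] := prSn _ pS.
have := AE _ pS; rewrite /A; case: insubP => [p' _ pE|]; last by rewrite pS.
have -> : p' = p by apply: val_inj.
move=> <-.
have -> : ((g * u)%N%:Z * y'%:Z - signed s (g * v) * x'%:Z =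
    g%:Z * (u%:Z * y'%:Z - signed s v * x'%:Z))%R.
  by rewrite /signed; case: s {AE}; rewrite !PoszM; ring.
rewrite [RHS]dvdzE abszM Gauss_dvdr ?absz_nat ?prime_coprime //.
Qed.
End Representations.

(** * Values of x^2 + D y^2 have density zero *)

Section Values.
Local Open Scope nat_scope.

Definition is_value D n :=
  [exists x : 'I_n.+1, [exists y : 'I_n.+1, n == x ^ 2 + D * y ^ 2]].

Lemma is_valueP D n : 0 < D ->
  reflect (exists x y, n = x ^ 2 + D * y ^ 2) (is_value D n).
Proof.
move=> D0; apply: (iffP existsP) => [[x /existsP[y /eqP e]]|[x [y e]]].
  by exists x, y.
have xn : x < n.+1.
  rewrite ltnS e (leq_trans _ (leq_addr _ _)) //; case: x {e} => // x.
  by rewrite expnS leq_pmulr // expn_gt0.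
have yn : y < n.+1.
  rewrite ltnS e (leq_trans _ (leq_addl _ _)) //; case: y {e} => // y.
  by rewrite expnS mulnCA leq_pmulr // muln_gt0 D0 expn_gt0.
by exists (Ordinal xn); apply/existsP; exists (Ordinal yn); apply/eqP.
Qed.

(** Each of the 2 B^2 triples represents at most one n for each k. *)
Lemma sum_represents D B N :
  \sum_(1 <= n < N) #|@represents D B n| <= D.+1 * (2 * B ^ 2).
Proof.
have cardE n : #|@represents D B n| <=
    \sum_(z : 'I_B * 'I_B * bool) \sum_(k < D.+1) (z.1.1 ^ 2 + D * z.1.2 ^ 2 == k.+1 * n).
  rewrite -sum1_card big_mkcond /=; apply: leq_sum => z _.
  rewrite unfold_in; case: existsP => // -[k kz].
  by rewrite (bigD1 k) //= kz leq_addr.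
apply: leq_trans (leq_sum _ (fun n _ => cardE n)) _.
rewrite exchange_big /=.
have -> : D.+1 * (2 * B ^ 2) = \sum_(z : 'I_B * 'I_B * bool) D.+1.
  rewrite sum_nat_const !card_prod !card_ord card_bool mulnC; congr (_ * _).
  by rewrite mulnC mulnn.
apply: leq_sum => z _; rewrite exchange_big /=.
rewrite -[leqRHS]muln1 -[X in X * 1]card_ord -sum_nat_const.
apply: leq_sum => k _.
pose q := z.1.1 ^ 2 + D * z.1.2 ^ 2.
apply: (@leq_trans (count (pred1 (q %/ k.+1)) (index_iota 1 N))).
  rewrite -sum1_count [leqRHS]big_mkcond; apply: leq_sum => n _ /=; rewrite -/q.
  by case: eqP => // ->; rewrite mulKn // eqxx.
by rewrite count_uniq_mem ?iota_uniq //; case: (_ \in _).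
Qed.
End Values.

Section Density.
Local Open Scope ring_scope.
Variable R : archiRealFieldType.

(** If n > 0 is a value, its weight w and the number r of its representations
    satisfy w r >= 1, so l w + r / l >= 2 for each l > 0; sum this over n. *)
Lemma count_values_le D S (l : R) N : (0 < D)%N -> uniq S -> 0 < l -> (0 < N)%N ->
  (forall p, p \in S -> prime p /\ (D.+1 < p)%N) ->
  (count (is_value D) (iota 0 N))%:R <=
    1 + l * (\sum_(0 <= n < N) weight R S n) + l^-1 * (8 * D.+1%:R ^+ 3 * N%:R).
Proof.
move=> D0 uS l0 N0 prS.
have [t /andP[t1 t2]] := nat_sqrt_exists N.
(* B bounds all coordinates in question, since (D + 1) N < B^2. *)
pose B := (D.+1 * t.+1)%N.
have t0 : (0 < t)%N by case: t t1 t2 {B} => // _; rewrite exp1n ltnS leqNgt N0.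
have B2 : (B ^ 2 <= 4 * D.+1 ^ 2 * N)%N.
  have t4 : (t.+1 ^ 2 <= 4 * N)%N by move: t1 t0; rewrite -!mulnn; clear; nia.
  by rewrite /B expnMn -mulnA mulnCA leq_mul2l t4 orbT.
have hB n m : (n < N)%N -> (m ^ 2 <= D.+1 * n -> m < B)%N.
  move=> nN mn; rewrite -(@ltn_exp2r m B 2) //.
  apply: leq_ltn_trans mn _; rewrite /B expnMn.
  by apply: leq_trans (_ : D.+1 * N <= _)%N; rewrite ?ltn_pmul2l // leq_mul ?leq_pmulr // ltnW.
have key n : (0 < n < N)%N -> (is_value D n)%:R <=
    l * weight R S n + l^-1 * #|@represents D B n|%:R.
  move=> /andP[n0 nN].
  have w0 : 0 <= weight R S n by rewrite weightE invr_ge0 exprn_ge0.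
  have [/(is_valueP _ D0)[x [y e]]|_] := boolP (is_value D n); last first.
    by rewrite addr_ge0 // mulr_ge0 ?invr_ge0 // ltW.
  have := many_representations D0 n0 e uS prS (fun m => @hB n m nN).
  rewrite -(ler_nat R) natrX weightE.
  move: (2 ^+ _) (exprn_gt0 (count (exactly_divides^~ n) S) (ltr0n R 2)) => a a0.
  move: (#|_|%:R) => r ar.
  apply: le_trans (_ : l * a^-1 + l^-1 * a <= _); last first.
    by rewrite lerD2l ler_pM2l ?invr_gt0.
  have -> : l^-1 * a = (l * a^-1)^-1 by rewrite invfM invrK.
  have : 0 < l * a^-1 by rewrite divr_gt0.
  move: (l * _) => x' x0.
  have xx : x' * x'^-1 = 1 by rewrite divff // gt_eqF.
  have : 0 < x'^-1 by rewrite invr_gt0.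
  move: (x'^-1) xx => y' xx y0.
  by change (1 <= x' + y'); nra.
rewrite -sum1_count big_mkcond /= -[X in iota 0 X]subn0 -/(index_iota 0 N).
rewrite natr_sum.
rewrite big_ltn // -addrA; apply: lerD; first by case: ifP.
rewrite [X in l * X]big_ltn // mulrDr -!addrA ler_wpDl //.
  by rewrite mulr_ge0 ?(ltW l0) // weightE invr_ge0 exprn_ge0.
apply: le_trans (_ : \sum_(1 <= n < N) (l * weight R S n + l^-1 * #|@represents D B n|%:R) <= _).
  rewrite big_nat [leRHS]big_nat; apply: ler_sum => n /key; apply: le_trans.
  by case: ifP.
rewrite big_split /= -!mulr_sumr lerD2l ler_pM2l ?invr_gt0 // -natr_sum.
rewrite -natrX -!natrM ler_nat (leq_trans (sum_represents D B N)) //.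
by move: B2; nia.
Qed.

Theorem values_density_zero D (e : R) : (0 < D)%N -> 0 < e ->
  exists N0, forall N, (N0 <= N)%N -> (count (is_value D) (iota 0 N))%:R <= e * N%:R.
Proof.
move=> D0 e0.
(* Each of the three terms of count_values_le is made at most e N / 3. *)
pose c : R := 8 * D.+1%:R ^+ 3.
have c0 : 0 < c by rewrite mulr_gt0 ?exprn_gt0 ?ltr0n.
pose l := 3 * c / e; have l0 : 0 < l by rewrite divr_gt0 ?mulr_gt0.
have [S [uS prS mS]] := @mean_weight_small R D.+1 (e / (3 * l)) (divr_gt0 e0 (mulr_gt0 (ltr0n _ 3) l0)).
have [K hK] := @sum_weight R S uS (fun p pS => (prS p pS).1).
pose A := 3 * (1 + l * K) / e.
exists (Num.bound `|A|).+1 => N hN.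
have N0 : (0 < N)%N by apply: leq_trans hN.
apply: le_trans (count_values_le D0 uS l0 N0 prS) _.
have := hK N; rewrite ler_distl => /andP[_ w].
have AN : A <= N%:R.
  apply: le_trans (ler_norm _) _; apply: le_trans (ltW (archi_boundP (normr_ge0 A))) _.
  by rewrite ler_nat ltnW.
have h1 : 1 + l * K <= e * N%:R / 3.
  by move: AN; rewrite /A ler_pdivrMr //; lra.
have h2 : l * (mean_weight R S * N%:R) <= e * N%:R / 3.
  have -> : e * N%:R / 3 = l * (e / (3 * l) * N%:R).
    by field; rewrite gt_eqF.
  by rewrite ler_pM2l // ler_wpM2r // ltW.
have h3 : l^-1 * (c * N%:R) = e * N%:R / 3.
  by rewrite /l; field; rewrite !gt_eqF.
have : l * (\sum_(0 <= n < N) weight R S n) <= l * (mean_weight R S * N%:R + K).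
  by rewrite ler_pM2l // addrC -lerBlDr; lra.
rewrite -/c h3; lra.
Qed.
End Density.

(** * Integer polynomials modulo a power of X *)

Section Truncation.
Local Open Scope ring_scope.
Implicit Types (p q r : {poly int}) (M : nat).

(** Congruence modulo 'X^M. *)
Definition eqX M p q := forall m, (m < M)%N -> p`_m = q`_m.

Lemma eqX_sym M p q : eqX M p q -> eqX M q p.
Proof. by move=> h m /h. Qed.

Lemma eqX_trans M q p r : eqX M p q -> eqX M q r -> eqX M p r.
Proof. by move=> h1 h2 m mM; rewrite h1 // h2. Qed.

Lemma eqX_le M' M p q : (M <= M')%N -> eqX M' p q -> eqX M p q.
Proof. by move=> MM h m mM; apply: h; apply: leq_trans MM. Qed.

Lemma eqXM M p p' q q' : eqX M p p' -> eqX M q q' -> eqX M (p * q) (p' * q').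
Proof.
move=> h1 h2 m mM; rewrite !coefM; apply: eq_bigr => i _.
by rewrite h1 ?h2 // (leq_ltn_trans _ mM) ?leq_subr // -ltnS.
Qed.

Lemma eqX_exp M p q k : eqX M p q -> eqX M (p ^+ k) (q ^+ k).
Proof. by move=> h; elim: k => [|k IH]; rewrite ?exprS; [|apply: eqXM]. Qed.

Lemma eqX_prod M (I : Type) (s : seq I) (P : pred I) (F G : I -> {poly int}) :
  (forall i, P i -> eqX M (F i) (G i)) ->
  eqX M (\prod_(i <- s | P i) F i) (\prod_(i <- s | P i) G i).
Proof.
by move=> h; elim/big_ind2: _ => // *; exact: eqXM.
Qed.

Lemma eqX_cancel M p q r : p`_0 = 1 -> eqX M (p * q) (p * r) -> eqX M q r.
Proof.
move=> p0 h; have {}h m : (m < M)%N -> (p * (q - r))`_m = 0.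
  by move=> /h; rewrite mulrBr coefB => ->; rewrite subrr.
suff H m : (m < M)%N -> (q - r)`_m = 0.
  by move=> m /H; rewrite coefB => /eqP; rewrite subr_eq0 => /eqP.
elim/ltn_ind: m => m IH mM; have := h m mM.
rewrite coefM big_ord_recl /= p0 mul1r subn0 big1 ?addr0 // => i _.
by rewrite IH ?mulr0 //; rewrite /bump /=; have := ltn_ord i; lia.
Qed.

Lemma eqX_XnM s M p q : eqX M p q -> eqX (s + M) ('X^s * p) ('X^s * q).
Proof.
move=> h m mM; rewrite !coefXnM; case: ltnP => // sm.
by apply: h; rewrite ltn_subLR.
Qed.

Lemma eqX_Xn0 M s p : (M <= s)%N -> eqX M ('X^s * p) 0.
Proof. by move=> Ms m mM; rewrite coefXnM coef0 (leq_trans mM Ms). Qed.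

(** Exponents below M at which p has a non-zero coefficient satisfy P. *)
Definition supported M (P : nat -> Prop) p := forall m, (m < M)%N -> p`_m != 0 -> P m.

Lemma supported_eqX M P p q : eqX M p q -> supported M P q -> supported M P p.
Proof. by move=> h s m mM; rewrite h //; apply: s. Qed.

Lemma supportedD M P p q : supported M P p -> supported M P q -> supported M P (p + q).
Proof.
move=> hp hq m mM; rewrite coefD; have [p0|/(hp m mM)//] := eqVneq p`_m 0.
by rewrite p0 add0r => /(hq m mM).
Qed.

Lemma supported_sum M P (I : Type) (s : seq I) (Q : pred I) (F : I -> {poly int}) :
  (forall i, Q i -> supported M P (F i)) -> supported M P (\sum_(i <- s | Q i) F i).
Proof.
move=> h; elim/big_ind: _ => //; last by move=> *; exact: supportedD.
by move=> m _; rewrite coef0 eqxx.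
Qed.

Lemma supportedZXn M P (a : int) s : (s < M -> P s)%N -> supported M P (a *: 'X^s).
Proof.
move=> h m mM; rewrite coefZ coefXn; have [ms _|_] := eqVneq m s; last by rewrite mulr0 eqxx.
by move: mM; rewrite ms.
Qed.

Lemma supportedM M P Q p q : supported M P p -> supported M Q q ->
  supported M (fun m => exists i j, [/\ m = (i + j)%N, P i & Q j]) (p * q).
Proof.
move=> hp hq m mM; rewrite coefM => nz.
have [j] : exists j : 'I_m.+1, p`_j * q`_(m - j) != 0.
  apply/existsP; apply: contraNT nz => /existsPn h; apply/eqP.
  by apply: big1 => j _; have := h j; rewrite negbK => /eqP.
rewrite mulf_eq0 negb_or => /andP[nzp nzq]; exists j, (m - j)%N.
have jm : (j <= m)%N by rewrite -ltnS.
split; first by rewrite subnKC.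
  by apply: hp nzp; apply: leq_ltn_trans mM.
by apply: hq nzq; apply: leq_ltn_trans (leq_subr _ _) mM.
Qed.

Lemma supported_comp_Xn M P p c : (0 < c)%N -> supported M P p ->
  supported M (fun m => exists i, m = (c * i)%N /\ P i) (p \Po 'X^c).
Proof.
move=> c0 h m mM; rewrite coef_comp_poly_Xn //; case: ifP => [|_]; last by rewrite eqxx.
move=> /dvdnP[k mE]; rewrite mE mulnK // => nz; exists k; split; first exact: mulnC.
by apply: h nz; apply: leq_ltn_trans mM; rewrite mE leq_pmulr.
Qed.
End Truncation.

(** * Gauss binomial coefficients and the triple product *)

Section GaussBinomials.
Local Open Scope ring_scope.

Fixpoint gauss_binomial (S : comNzRingType) (q : S) n k : S :=
  match n, k with
  | _, 0 => 1
  | 0, _.+1 => 0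
  | n'.+1, k'.+1 => gauss_binomial q n' k' + q ^+ k * gauss_binomial q n' k
  end.

(** The q-Pochhammer symbol (q; q)_n. *)
Definition qpoch (S : comNzRingType) (q : S) n := \prod_(1 <= i < n.+1) (1 - q ^+ i).

Lemma qpochS (S : comNzRingType) (q : S) n : qpoch q n.+1 = qpoch q n * (1 - q ^+ n.+1).
Proof. by rewrite /qpoch big_nat_recr. Qed.

Lemma qpoch0 (S : comNzRingType) (q : S) : qpoch q 0 = 1.
Proof. by rewrite /qpoch big_geq. Qed.

Lemma gauss_binomial0 (S : comNzRingType) (q : S) n : gauss_binomial q n 0 = 1.
Proof. by case: n. Qed.

Lemma gauss_binomial_small (S : comNzRingType) (q : S) n k :
  (n < k)%N -> gauss_binomial q n k = 0.
Proof.
elim: n k => [|n IH] [|k] //=; rewrite ltnS => nk.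
by rewrite !IH ?mulr0 ?addr0 // ltnW.
Qed.

Lemma gauss_binomialS (S : comNzRingType) (q : S) n k :
  gauss_binomial q n.+1 k.+1 =
  gauss_binomial q n k + q ^+ k.+1 * gauss_binomial q n k.+1.
Proof. by []. Qed.

Lemma gauss_binomial_rmorph (S T : comNzRingType) (f : {rmorphism S -> T}) q n k :
  f (gauss_binomial q n k) = gauss_binomial (f q) n k.
Proof.
elim: n k => [|n IH] [|k] /=; rewrite ?rmorph0 ?rmorph1 //.
by rewrite rmorphD rmorphM rmorphXn !IH.
Qed.

(** Division-free form of the quotient formula for Gauss binomials. *)
Lemma gauss_binomial_qpoch (S : comNzRingType) (q : S) m k :
  gauss_binomial q (m + k) k * qpoch q k * qpoch q m = qpoch q (m + k).
Proof.
elim: m k => [|m IHm] k.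
  rewrite add0n qpoch0 mulr1; elim: k => [|k IH]; first by rewrite qpoch0 mulr1.
  by rewrite /= (gauss_binomial_small _ (ltnSn k)) mulr0 addr0 qpochS mulrA IH.
elim: k => [|k IHk]; first by rewrite addn0 gauss_binomial0 qpoch0 !mul1r.
have h := IHm k.+1.
rewrite addnS in h; rewrite addSn in IHk; rewrite addSn addnS gauss_binomialS.
rewrite [RHS]qpochS.
have -> : 1 - q ^+ (m + k).+2 = (1 - q ^+ k.+1) + q ^+ k.+1 * (1 - q ^+ m.+1) :> S.
  by rewrite mulrBr mulr1 -exprD addSn addnS [(k + m)%N]addnC; ring.
have e1 : qpoch q (m + k).+1 * (1 - q ^+ k.+1) =
    gauss_binomial q (m + k).+1 k * qpoch q k.+1 * qpoch q m.+1.
  by rewrite -IHk [qpoch q k.+1]qpochS; ring.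
have e2 : qpoch q (m + k).+1 * (q ^+ k.+1 * (1 - q ^+ m.+1)) =
    q ^+ k.+1 * gauss_binomial q (m + k).+1 k.+1 * qpoch q k.+1 * qpoch q m.+1.
  by rewrite -h [qpoch q m.+1]qpochS; ring.
rewrite [RHS]mulrDr e1 e2; ring.
Qed.

(** Factor out i = 0 and apply the induction hypothesis to z q. *)
Lemma q_binomial (S : comNzRingType) (q y z : S) n :
  \prod_(i < n) (y + z * q ^+ i) =
  \sum_(k < n.+1) q ^+ 'C(k, 2) * gauss_binomial q n k * (z ^+ k * y ^+ (n - k)).
Proof.
elim: n z => [|n IH] z.
  by rewrite big_ord0 big_ord_recl big_ord0 /= !mulr1 addr0.
rewrite big_ord_recl expr0 mulr1.
have -> : \prod_(i < n) (y + z * q ^+ bump 0 i) = \prod_(i < n) (y + (z * q) * q ^+ i).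
  by apply: eq_bigr => i _; rewrite /bump /= exprS mulrA.
rewrite IH mulrDl !mulr_sumr.
rewrite [RHS]big_ord_recl /= expr0 !mul1r subn0.
have -> : \sum_(i < n.+1) q ^+ 'C(bump 0 i, 2) *
   (gauss_binomial q n (0+i)%N + q ^+ i.+1 * gauss_binomial q n i.+1) *
   (z ^+ bump 0 i * y ^+ (n.+1 - bump 0 i)) =
  \sum_(i < n.+1) z * (q ^+ 'C(i, 2) * gauss_binomial q n i * ((z * q) ^+ i * y ^+ (n - i)))
  + \sum_(i < n.+1) q ^+ 'C(i.+1, 2) * gauss_binomial q n i.+1 * ((z * q) ^+ i.+1 * y ^+ (n - i)).
  rewrite -big_split; apply: eq_bigr => i _ /=.
  rewrite /bump /= !add1n add0n subSS binS bin1 !exprMn exprD !exprS; ring.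
rewrite addrA [y ^+ n.+1 + _]addrC -addrA addrC; congr (_ + _).
rewrite big_ord_recl [in RHS]big_ord_recr /= (gauss_binomial_small _ (ltnSn n)).
rewrite gauss_binomial0 !expr0 !mul1r subn0 mulr0 mul0r addr0 exprS; congr (_ + _).
apply: eq_bigr => i _; rewrite /bump /= add1n.
have -> : y ^+ (n - i) = y * y ^+ (n - i.+1) by rewrite -exprS subnSK.
move: (y ^+ _) => y'; ring.
Qed.
End GaussBinomials.

#[global] Arguments gauss_binomial : simpl never.

Section TripleProduct.
Local Open Scope ring_scope.

(** With k = n + j, this is j (j - 1) / 2 for each integer j, written with
    truncated subtractions: one of the two binomials is always zero. *)
Definition theta_exponent n k := ('C(k - n, 2) + 'C((n - k).+1, 2))%N.

Lemma bin2_square j : (2 * 'C(j, 2) + j = j * j)%N.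
Proof. by elim: j => // j IH; rewrite binS bin1; lia. Qed.

Lemma bin2D a b : 'C(a + b, 2) = ('C(a, 2) + 'C(b, 2) + a * b)%N.
Proof.
elim: a => [|a IH]; first by rewrite add0n addn0.
by rewrite addSn !binS !bin1 IH; lia.
Qed.

Lemma theta_exponentE n k : (k <= n.*2)%N ->
  ('C(k, 2) + n * (n.*2 - k) = 'C(n, 2) + n * n + theta_exponent n k)%N.
Proof.
rewrite /theta_exponent => kn; have [nk|kn'] := leqP n k.
  have [j jE] : exists j, k = (n + j)%N by exists (k - n)%N; lia.
  subst k; rewrite addKn (_ : (n - (n + j) = 0)%N) ?bin2D; last lia.
  have -> : 'C(1, 2) = 0%N by [].
  have -> : (n.*2 - (n + j) = n - j)%N by lia.
  have := mulnBr n n j; have : (n * j <= n * n)%N by rewrite leq_mul2l; lia.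
  lia.
have [j jE] : exists j, n = (k + j)%N by exists (n - k)%N; lia.
subst n; rewrite addKn (_ : (k - (k + j) = 0)%N) ?bin2D; last lia.
have -> : ((k + j).*2 - k = k + j + j)%N by lia.
rewrite binS bin1 bin0n /=.
have := bin2_square j; nia.
Qed.

(** The q-binomial theorem for prod_{i < 2n} (q^n + z q^i): taking the largest
    power of q out of each factor leaves the product on the left, and
    theta_exponentE says that the same power comes out of each term. *)
Lemma finite_jacobi_triple_product (S : idomainType) (q z : S) n : q != 0 ->
  \prod_(i < n) ((z + q ^+ i.+1) * (1 + z * q ^+ i)) =
  \sum_(k < n.*2.+1) q ^+ theta_exponent n k * gauss_binomial q n.*2 k * z ^+ k.
Proof.
move=> q0.
apply: (@mulfI _ (q ^+ ('C(n, 2) + n * n))); first by rewrite expf_neq0.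
transitivity (\prod_(i < n.*2) (q ^+ n + z * q ^+ i)); last first.
  rewrite q_binomial mulr_sumr; apply: eq_bigr => k _.
  rewrite -exprM mulrCA [RHS]mulrA [in RHS]mulrA -exprD -(@theta_exponentE n k) -1?ltnS //.
  by rewrite exprD; ring.
have qn : \prod_(i < n) q ^+ i = q ^+ 'C(n, 2).
  elim: n => [|n IH]; first by rewrite big_ord0.
  by rewrite big_ord_recr /= IH -exprD binS bin1 addnC.
rewrite -addnn big_split_ord /= big_split /= exprD [in LHS]mulrACA; congr (_ * _).
  rewrite (reindex_inj rev_ord_inj) /= -qn -big_split; apply: eq_bigr => i _ /=.
  rewrite mulrDr -exprD mulrC addrC; congr (q ^+ _ + _).
  by rewrite subnSK ?subnKC // ltnW.
have -> : q ^+ (n * n) = \prod_(i < n) q ^+ n by rewrite prodr_const card_ord exprM.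
rewrite -big_split; apply: eq_bigr => i _ /=.
by rewrite exprD; ring.
Qed.

Lemma qpoch_eqX c m n M : (0 < c)%N -> (M <= m)%N -> (M <= n)%N ->
  eqX M (qpoch 'X^c m) (qpoch ('X^c : {poly int}) n).
Proof.
move=> c0.
have H k : (M <= k)%N -> eqX M (qpoch 'X^c M) (qpoch ('X^c : {poly int}) k).
  elim: k => [|k IH]; first by rewrite leqn0 => /eqP->.
  rewrite leq_eqVlt => /orP[/eqP->//|Mk]; have {}IH := IH Mk.
  rewrite qpochS -[X in eqX _ X _]mulr1; apply: eqXM => // i iM.
  rewrite coefB -exprM coefXn; case: eqP => [iE|_]; last by rewrite subr0.
  by move: iM; rewrite iE; nia.
by move=> /H h1 /H h2; apply: eqX_trans h2; apply: eqX_sym.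
Qed.

Lemma qpoch_coef0 c n : (0 < c)%N -> (qpoch ('X^c : {poly int}) n)`_0 = 1.
Proof.
move=> c0; elim: n => [|n IH]; first by rewrite qpoch0 coef1.
rewrite qpochS coefM big_ord1 subn0 IH mul1r coefB coef1 eqxx -exprM coefXn.
by case: eqP => [|_]; [lia | rewrite subr0].
Qed.

(** The quotient formula says that the binomial times (q; q)_k (q; q)_(n-k) is
    (q; q)_n, and all these products agree modulo 'X^M when k and n - k are at
    least M. *)
Lemma gauss_binomial_eqX c n k M : (0 < c)%N -> (M <= k)%N -> (M + k <= n)%N ->
  eqX M (qpoch 'X^c M * gauss_binomial ('X^c : {poly int}) n k) 1.
Proof.
move=> c0 Mk kn; apply: (@eqX_cancel _ (qpoch 'X^c M)); first exact: qpoch_coef0.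
have := gauss_binomial_qpoch ('X^c : {poly int}) (n - k) k.
rewrite subnK; last by lia.
move=> h; rewrite mulr1.
apply: (@eqX_trans _ (qpoch 'X^c n)); last by apply: qpoch_eqX; lia.
rewrite -h mulrA mulrC mulrA; apply: eqXM; last by apply: qpoch_eqX; lia.
by apply: eqXM => //; apply: qpoch_eqX; lia.
Qed.
End TripleProduct.

(** * Supports of the theta series of Euler, Gauss and Jacobi *)

Section ThetaSupports.
Local Open Scope ring_scope.

Lemma supported_polyCM M P a (p : {poly int}) : supported M P p -> supported M P (a%:P * p).
Proof.
by move=> h m mM; rewrite coefCM mulf_eq0 negb_or => /andP[_]; exact: h.
Qed.

Lemma supported_sign k M P (p : {poly int}) : supported M P p -> supported M P ((-1) ^+ k * p).
Proof.
have -> : (-1) ^+ k = ((-1) ^+ k)%:P :> {poly int} by rewrite rmorphXn rmorphN1.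
exact: supported_polyCM.
Qed.

(** Completing the square turns the exponents of a theta series into squares, the
    form in which two of them add up to a binary quadratic form. *)
Definition triangular m := exists x, (8 * m + 1 = x ^ 2)%N.
Definition pentagonal m := exists x, (24 * m + 1 = x ^ 2)%N.

Lemma theta_exponent_square n k : exists j,
  (k = n + j /\ 2 * theta_exponent n k + j = j * j)%N \/
  (n = k + j /\ 2 * theta_exponent n k = j * j + j)%N.
Proof.
rewrite /theta_exponent; have [nk|kn] := leqP n k.
  exists (k - n)%N; left; rewrite subnKC // (_ : (n - k = 0)%N); last lia.
  by rewrite addn0 bin2_square.
exists (n - k)%N; right; rewrite subnKC 1?ltnW // (_ : (k - n = 0)%N); last lia.
by have := bin2_square (n - k).+1; rewrite bin0n; lia.
Qed.

(** A term of the finite triple product is negligible modulo 'X^M unless its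
    exponent is below M, and then its index is near the middle, where the
    normalised Gauss binomial is 1. *)
Lemma theta_term c n k t M N :
  (0 < c)%N -> (t < M -> M <= k /\ M + k <= n)%N -> (M <= N)%N ->
  eqX M ('X^t * (qpoch 'X^c N * gauss_binomial ('X^c : {poly int}) n k)) 'X^t.
Proof.
move=> c0 h MN; have [Mt|/h[Mk kn]] := leqP M t.
  apply: (@eqX_trans _ 0); first exact: eqX_Xn0.
  by apply: eqX_sym; rewrite -['X^t]mulr1; apply: eqX_Xn0.
rewrite -[X in eqX _ _ X]mulr1; apply: eqXM => //.
apply: eqX_trans (gauss_binomial_eqX c0 Mk kn); apply: eqXM => //.
exact: qpoch_eqX.
Qed.

Lemma qpoch_ord (S : comNzRingType) (q : S) n :
  qpoch q n = \prod_(i < n) (1 - q ^+ i.+1).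
Proof. by rewrite /qpoch big_add1 big_mkord. Qed.

Lemma qpoch3 n : qpoch ('X : {poly int}) (3 * n) =
  \prod_(i < n) ((1 - 'X^(3 * i + 2)) * (1 - 'X^(3 * i + 1))) * qpoch 'X^3 n.
Proof.
elim: n => [|n IH]; first by rewrite muln0 big_ord0 !qpoch0 mulr1.
rewrite mulnS !addSn add0n !qpochS IH big_ord_recr /= -!exprM.
rewrite !addnS !addn0 mulnS !addSn add0n; ring.
Qed.

(** Triple product with q = X^3 and z = - X, whose factors run through the
    1 - X^i with i prime to 3; multiplying by (X^3; X^3)_n restores the
    others. *)
Lemma euler_supported M N : (M <= N)%N ->
  supported M pentagonal (qpoch ('X : {poly int}) N).
Proof.
move=> MN; have [n hn] : exists n, (M.*2 + 2 <= n)%N by exists (M.*2 + 2)%N.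
have X30 : 'X^3 != 0 :> {poly int} by rewrite expf_neq0 // polyX_eq0.
have := @finite_jacobi_triple_product {poly int} 'X^3 (- 'X) n X30.
rewrite (eq_bigr (fun i : 'I_n => - 'X * ((1 - 'X^(3 * i + 2)) * (1 - 'X^(3 * i + 1))))); last first.
  move=> i _; rewrite -!exprM mulnS.
  have -> : 'X^(3 + 3 * i) = 'X * 'X^(3 * i + 2) :> {poly int} by rewrite -exprS; congr 'X^_; lia.
  by rewrite addn1 [in RHS]exprS; ring.
rewrite big_split prodr_const card_ord /=.
(* Both sides carry a factor 'X^n; t k is the exponent that remains. *)
pose t k := (3 * theta_exponent n k + k - n)%N.
have tk k : (3 * theta_exponent n k + k = n + t k)%N.
  by rewrite /t subnKC //; have [j] := theta_exponent_square n k; nia.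
move=> jtp.
have {}jtp : (-1) ^+ n * qpoch ('X : {poly int}) (3 * n) = \sum_(k < n.*2.+1)
    (-1) ^+ k * ('X^(t k) * (qpoch 'X^3 n * gauss_binomial 'X^3 n.*2 k)).
  apply: (@mulfI _ 'X^n); first by rewrite expf_neq0 // polyX_eq0.
  rewrite qpoch3 !mulrA -exprMn_comm; last exact: mulrC.
  rewrite mulrN1 jtp mulr_suml mulr_sumr; apply: eq_bigr => k _.
  rewrite [(- 'X) ^+ k]exprNn -exprM.
  transitivity ((-1) ^+ k * 'X^(3 * theta_exponent n k + k) *
    (qpoch 'X^3 n * gauss_binomial 'X^3 n.*2 k) : {poly int}).
    by rewrite exprD; ring.
  by rewrite tk exprD; ring.
have : supported M pentagonal ((-1) ^+ n * qpoch ('X : {poly int}) (3 * n)).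
  rewrite jtp; apply: supported_sum => k _; apply: supported_sign.
  apply: (@supported_eqX _ _ _ 'X^(t k)); first apply: theta_term => //; try lia.
    move=> tM; have := tk k; have [j] := theta_exponent_square n k; have := ltn_ord k.
    nia.
  rewrite -['X^_]scale1r; apply: supportedZXn => _.
  have := tk k; have [j [[kE e2]|[kE e2]]] := theta_exponent_square n k => tE.
    have {}tE : (t k = 3 * theta_exponent n k + j)%N by lia.
    rewrite tE; case: j kE e2 {tE} => [|j] kE e2; first by exists 1%N; lia.
    by exists (6 * j + 5)%N; rewrite -mulnn; lia.
  have {}tE : (t k + j = 3 * theta_exponent n k)%N by lia.
  by exists (6 * j + 1)%N; rewrite -mulnn; lia.
move=> /(supported_sign (k := n)); rewrite signrMK.
by apply: supported_eqX; apply: (@qpoch_eqX 1) => //; clear -MN hn; lia.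
Qed.

Lemma theta_exponent_triangular n k : triangular (theta_exponent n k).
Proof.
have [j [[_ e2]|[_ e2]]] := theta_exponent_square n k.
  case: j e2 => [|j] e2; first by exists 1%N; lia.
  by exists (2 * j + 1)%N; rewrite -mulnn; lia.
by exists (2 * j + 1)%N; rewrite -mulnn; lia.
Qed.

Lemma theta_sum_triangular c M n N K (a : nat -> int) :
  (0 < c)%N -> (M.*2 + 2 <= n)%N -> (M <= N)%N -> (K <= n.*2.+1)%N ->
  supported M triangular (\sum_(k < K)
    (a k)%:P * ('X^(theta_exponent n k) *
      (qpoch 'X^c N * gauss_binomial ('X^c : {poly int}) n.*2 k))).
Proof.
move=> c0 hn MN KN; apply: supported_sum => k _; apply: supported_polyCM.
apply: (@supported_eqX _ _ _ 'X^(theta_exponent n k)).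
  apply: theta_term => // tM.
  have [j] := theta_exponent_square n k; have := ltn_ord k.
  clear a; nia.
rewrite -['X^_]scale1r; apply: supportedZXn => _; exact: theta_exponent_triangular.
Qed.

Lemma qpoch_plus n : qpoch ('X : {poly int}) n * \prod_(i < n) (1 + 'X^(i.+1)) = qpoch 'X^2 n.
Proof.
rewrite !qpoch_ord -big_split; apply: eq_bigr => i _ /=.
by rewrite -exprM mulnC exprM; ring.
Qed.

(** Triple product with q = X and z = 1. Its factor 1 + X^0 = 2 is harmless: a
    polynomial and its double have the same support. *)
Lemma gauss_supported M N p : (M <= N)%N ->
  eqX M (qpoch 'X N * p) (qpoch 'X^2 N ^+ 2) -> supported M triangular p.
Proof.
move=> MN hp; have [n hn] : exists n, (M.*2 + 2 <= n.+1)%N by exists (M.*2 + 2)%N.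
pose B n : {poly int} := \prod_(i < n) (1 + 'X^(i.+1)).
pose D := qpoch 'X n.+1 * B n.+1 * B n.
have jtp := @finite_jacobi_triple_product {poly int} 'X 1 n.+1 (negbT (polyX_eq0 _)).
have {}jtp : D + D = \sum_(k < n.+1.*2.+1)
    1%:P * ('X^(theta_exponent n.+1 k) *
      (qpoch 'X^1 n.+1 * gauss_binomial ('X^1 : {poly int}) n.+1.*2 k)).
  transitivity (qpoch 'X n.+1 * \prod_(i < n.+1) ((1 + 'X^(i.+1)) * (1 + 1 * 'X^i)) : {poly int}).
    rewrite /D big_split /= [X in _ = _ * (_ * X)]big_ord_recl expr0 mulr1.
    rewrite (eq_bigr (fun i : 'I_n => 1 + 'X^(i.+1))); last by move=> i _; rewrite mul1r.
    by rewrite -/(B n) -/(B n.+1); ring.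
  rewrite jtp mulr_sumr; apply: eq_bigr => k _.
  by rewrite expr1n expr1; ring.
have sD : supported M triangular D.
  have : supported M triangular (D + D).
    by rewrite jtp; apply: (@theta_sum_triangular 1 M n.+1 n.+1 _ (fun=> 1)) => //; lia.
  by move=> h m mM nz; apply: (h m mM); rewrite coefD; lia.
apply: supported_eqX sD; apply: (@eqX_cancel _ (qpoch 'X N)).
  exact: (@qpoch_coef0 1).
apply: eqX_trans hp _.
have n1 : (M <= n.+1)%N by lia.
have n0 : (M <= n)%N by lia.
have x1 k l : (M <= k)%N -> (M <= l)%N -> eqX M (qpoch 'X k) (qpoch 'X l).
  exact: (@qpoch_eqX 1).
have x2 k l : (M <= k)%N -> (M <= l)%N -> eqX M (qpoch 'X^2 k) (qpoch 'X^2 l).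
  exact: (@qpoch_eqX 2).
apply: (@eqX_trans _ (qpoch 'X^2 n.+1 * qpoch 'X^2 n)).
  by rewrite expr2; apply: eqXM; apply: x2.
rewrite -!qpoch_plus -/(B _) -/(B _).
have -> : qpoch 'X N * D = (qpoch 'X N * B n.+1) * (qpoch 'X n.+1 * B n) by rewrite /D; ring.
by apply: eqXM; apply: eqXM => //; apply: x1.
Qed.

(** Triple product with q = X and z a variable, which has the factor 1 + z;
    dividing by it and evaluating at z = -1 is the same as differentiating at
    -1, and this only multiplies the terms by integers. *)
Lemma jacobi_supported M N : (M <= N)%N ->
  supported M triangular (qpoch ('X : {poly int}) N ^+ 3).
Proof.
move=> MN; have [n hn] : exists n, (M.*2 + 2 <= n.+1)%N by exists (M.*2 + 2)%N.
have X0 : 'X%:P != 0 :> {poly {poly int}} by rewrite polyC_eq0 polyX_eq0.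
have jtp := @finite_jacobi_triple_product {poly {poly int}} 'X%:P 'X n.+1 X0.
pose Q : {poly {poly int}} := \prod_(i < n.+1) ('X + 'X%:P ^+ i.+1) *
  \prod_(i < n) (1 + 'X * 'X%:P ^+ i.+1).
have {}jtp : (1 + 'X) * Q = \sum_(k < n.+1.*2.+1)
    ('X^(theta_exponent n.+1 k) * gauss_binomial ('X : {poly int}) n.+1.*2 k)%:P * 'X^k.
  transitivity (\prod_(i < n.+1) (('X + 'X%:P ^+ i.+1) * (1 + 'X * 'X%:P ^+ i)) : {poly {poly int}}).
    rewrite big_split /= [X in _ = _ * X]big_ord_recl expr0 mulr1 /Q.
    by rewrite mulrCA.
  rewrite jtp; apply: eq_bigr => k _.
  by rewrite -(gauss_binomial_rmorph polyC) -rmorphXn -rmorphM.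
have {}jtp : Q.[-1] = \sum_(k < n.+1.*2.+1)
    'X^(theta_exponent n.+1 k) * gauss_binomial ('X : {poly int}) n.+1.*2 k * ((-1) ^+ k.-1 *+ k).
  have <- : ((1 + 'X) * Q)^`().[-1] = Q.[-1].
    rewrite derivM derivD derivX (derivC 1) add0r mul1r.
    by rewrite !hornerE subrr mul0r addr0.
  rewrite jtp.
  rewrite raddf_sum horner_sum; apply: eq_bigr => k _ /=.
  by rewrite deriv_mulC derivXn hornerCM hornerMn hornerXn.
have {}jtp : qpoch 'X N * ((-1) ^+ n.+1 * (qpoch 'X n.+1 * qpoch 'X n)) = \sum_(k < n.+1.*2.+1)
    ((-1) ^+ k.-1 *+ k)%:P * ('X^(theta_exponent n.+1 k) *
      (qpoch 'X^1 N * gauss_binomial ('X^1 : {poly int}) n.+1.*2 k)).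
  have <- : Q.[-1] = (-1) ^+ n.+1 * (qpoch 'X n.+1 * qpoch 'X n).
    rewrite /Q hornerM !horner_prod !qpoch_ord mulrA; congr (_ * _).
      rewrite -[X in (-1) ^+ X]card_ord -prodr_const -big_split; apply: eq_bigr => i _ /=.
      by rewrite hornerD hornerX -rmorphXn hornerC; ring.
    apply: eq_bigr => i _.
    by rewrite hornerD hornerM hornerX -rmorphXn !hornerC; ring.
  rewrite jtp mulr_sumr; apply: eq_bigr => k _.
  by rewrite rmorphMn rmorphXn rmorphN1 expr1; ring.
have : supported M triangular ((-1) ^+ n.+1 * (qpoch 'X N * (qpoch 'X n.+1 * qpoch 'X n))).
  rewrite mulrCA jtp.
  by apply: (@theta_sum_triangular 1 M n.+1 N _ (fun k => (-1) ^+ k.-1 *+ k)) => //; lia.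
move=> /(supported_sign (k := n.+1)); rewrite signrMK.
apply: supported_eqX; rewrite exprS expr2.
by apply: eqXM => //; apply: eqXM; apply: (@qpoch_eqX 1) => //; lia.
Qed.
End ThetaSupports.

(** * The generating series of 3-cores *)

Section ThreeCores.
Local Open Scope ring_scope.

(** 3 m + 1 is a norm from the Eisenstein integers, since
    4 (x^2 + x y + y^2) = (2 x + y)^2 + 3 y^2. *)
Definition eisenstein_norm m := exists x y, (4 * (3 * m + 1) = x ^ 2 + 3 * y ^ 2)%N.

Definition core_exponent k0 k1 k2 :=
  (3 * 'C(k0, 2) + (3 * 'C(k1, 2) + k1) + (3 * 'C(k2, 2) + 2 * k2))%N.

(** The exponent of a term of core_identity, once the common 'C(3n, 2) is
    removed. With l_j = k_j - n, so that l_0 + l_1 + l_2 = 0, it is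
    3 (l_1^2 + l_1 l_2 + l_2^2) + l_1 + 2 l_2. *)
Lemma core_exponentE n k0 k1 k2 : (k0 + k1 + k2 = 3 * n)%N ->
  exists m, core_exponent k0 k1 k2 = ('C(3 * n, 2) + m)%N /\
   (4 * (3 * m%:Z + 1) = (6 * (k1%:Z - n%:Z) + 3 * (k2%:Z - n%:Z) + 1) ^+ 2
      + 3 * (3 * (k2%:Z - n%:Z) + 1) ^+ 2)%R.
Proof.
move=> ks; rewrite /core_exponent.
have := bin2_square k0; have := bin2_square k1; have := bin2_square k2.
have := bin2_square (3 * n); move: 'C(3 * n, 2) 'C(k2, 2) 'C(k1, 2) 'C(k0, 2) => s c2 c1 c0 hs h2 h1 h0.
have k0E : k0%:Z = 3 * n%:Z - k1%:Z - k2%:Z by lia.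
have {}h0 : 2 * c0%:Z + k0%:Z = k0%:Z * k0%:Z by lia.
rewrite k0E in h0.
have key : 4 * (3 * ((3 * c0 + (3 * c1 + k1) + (3 * c2 + 2 * k2))%N%:Z - s%:Z) + 1) =
   (6 * (k1%:Z - n%:Z) + 3 * (k2%:Z - n%:Z) + 1) ^+ 2
      + 3 * (3 * (k2%:Z - n%:Z) + 1) ^+ 2 :> int.
  by move: hs h2 h1 h0; clear; lia.
have := sqr_ge0 (6 * (k1%:Z - n%:Z) + 3 * (k2%:Z - n%:Z) + 1 : int).
have := sqr_ge0 (3 * (k2%:Z - n%:Z) + 1 : int).
move: key; move: (_ ^+ 2) (_ ^+ 2) => a b key a0 b0.
exists (3 * c0 + (3 * c1 + k1) + (3 * c2 + 2 * k2) - s)%N.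
by clear -key a0 b0; split; lia.
Qed.

Lemma prod_split3 (S : comNzRingType) (f : nat -> S) n :
  \prod_(i < 3 * n) f i = \prod_(i < n) (f (3 * i)%N * f (3 * i + 1)%N * f (3 * i + 2)%N).
Proof.
elim: n => [|n IH]; first by rewrite muln0 !big_ord0.
rewrite mulnS !addSn add0n !big_ord_recr /= IH addn1 addn2 -!mulrA; congr (_ * _).
Qed.

(** The expansion in z of prod_{i < n} (1 + z X^(j + c i)), by the q-binomial
    theorem. *)
Definition core_factor c n j : {poly {poly int}} :=
  \poly_(k < n.+1) ('X^(c * 'C(k, 2) + j * k) * gauss_binomial 'X^c n k).

Lemma core_factorE c n j : core_factor c n j =
  \prod_(i < n) (1 + ('X * ('X^j)%:P) * ('X^c)%:P ^+ i).
Proof.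
rewrite q_binomial /core_factor poly_def; apply: eq_bigr => k _.
rewrite expr1n mulr1 -(gauss_binomial_rmorph polyC) -!rmorphXn exprMn -rmorphXn /=.
rewrite -mul_polyC -!exprM exprD mulnC [(j * k)%N]mulnC rmorphM rmorphM.
by ring.
Qed.

(** Sorting the factors of prod_{i < 6n} (1 + z X^i) by the residue of i modulo 3
    gives three such products in X^3; compare the coefficients of z^(3n). *)
Lemma core_identity n :
  'X^('C(3 * n, 2)) * gauss_binomial ('X : {poly int}) (6 * n) (3 * n) =
  (core_factor 3 (2 * n) 0 * core_factor 3 (2 * n) 1 * core_factor 3 (2 * n) 2)`_(3 * n).
Proof.
rewrite !core_factorE -!big_split /=.
have -> : \prod_(i < 2 * n) ((1 + 'X * ('X^0)%:P * ('X^3)%:P ^+ i) *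
   (1 + 'X * ('X^1)%:P * ('X^3)%:P ^+ i) * (1 + 'X * ('X^2)%:P * ('X^3)%:P ^+ i))
   = core_factor 1 (6 * n) 0.
  rewrite core_factorE (_ : 6 * n = 3 * (2 * n))%N; last by lia.
  rewrite (prod_split3 (fun i => 1 + 'X * ('X^0)%:P * ('X^1)%:P ^+ i)).
  apply: eq_bigr => i _; rewrite -!rmorphXn -!mulrA -!rmorphM -!exprM -!exprD.
  by rewrite !add0n !mul1n [(_ + 1)%N]addnC [(_ + 2)%N]addnC.
rewrite /core_factor coef_poly ifT ?mul1n ?mul0n ?addn0 ?expr1 //; lia.
Qed.

Lemma int_sqr_lt (a b : int) : 0 <= b -> a * a < b * b -> a < b /\ - a < b.
Proof. by split; nia. Qed.

(** Either the exponent is at least M, or k_0, k_1, k_2 are all near n and the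
    three normalised Gauss binomials are 1 modulo 'X^M. The constant 7 leaves
    room for the resulting bound |k_j - n| < 6 M. *)
Lemma core_term M n N k0 k1 k2 :
  (M <= N)%N -> (7 * M + 7 <= n)%N -> (k0 <= 2 * n)%N -> (k1 <= 2 * n)%N -> (k2 <= 2 * n)%N ->
  (k0 + k1 + k2 = 3 * n)%N ->
  supported ('C(3 * n, 2) + M) (fun m => exists m', m = ('C(3 * n, 2) + m')%N /\ eisenstein_norm m')
   (qpoch 'X^3 N ^+ 3 *
   ('X^(3 * 'C(k0, 2) + 0 * k0) * gauss_binomial ('X^3 : {poly int}) (2 * n) k0 *
   ('X^(3 * 'C(k1, 2) + 1 * k1) * gauss_binomial ('X^3 : {poly int}) (2 * n) k1) *
   ('X^(3 * 'C(k2, 2) + 2 * k2) * gauss_binomial ('X^3 : {poly int}) (2 * n) k2))).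
Proof.
move=> MN hn l0 l1 l2 ks.
have [m [mE m2]] := core_exponentE ks.
set g0 := gauss_binomial _ _ k0; set g1 := gauss_binomial _ _ k1; set g2 := gauss_binomial _ _ k2.
pose E := qpoch ('X^3 : {poly int}) N.
have -> : E ^+ 3 * ('X^(3 * 'C(k0, 2) + 0 * k0) * g0 * ('X^(3 * 'C(k1, 2) + 1 * k1) * g1)
     * ('X^(3 * 'C(k2, 2) + 2 * k2) * g2))
   = 'X^('C(3 * n, 2)) * ('X^m * ((E * g0) * (E * g1) * (E * g2))).
  rewrite [RHS]mulrA -exprD -mE /core_exponent mul0n addn0 mul1n !exprD; ring.
apply: (@supported_eqX _ _ _ ('X^('C(3 * n, 2)) * 'X^m)).
  apply: eqX_XnM; have [Mm|mM] := leqP M m.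
    apply: (@eqX_trans _ 0); first exact: eqX_Xn0.
    by apply: eqX_sym; rewrite -['X^m]mulr1; apply: eqX_Xn0.
  rewrite -[X in eqX _ _ X]mulr1; apply: eqXM => //.
  have bd : [/\ (M <= k0 /\ M + k0 <= 2 * n)%N, (M <= k1 /\ M + k1 <= 2 * n)%N
     & (M <= k2 /\ M + k2 <= 2 * n)%N].
    move: m2; set u := (6 * _ + _ + 1); set v := (3 * (k2%:Z - n%:Z) + 1) => m2.
    have hu : 0 <= u * u by rewrite -expr2 sqr_ge0.
    have hv : 0 <= v * v by rewrite -expr2 sqr_ge0.
    have MM : M%:Z <= M%:Z * M%:Z by move: mM; clear; nia.
    have [v1 v2] : v < 4 * M%:Z /\ - v < 4 * M%:Z.
      by apply: int_sqr_lt; first (clear; lia);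
        move: m2 mM hu MM; rewrite !expr2; move: (u) (v) => u' v'; clear; lia.
    have [u1 u2] : u < 12 * M%:Z /\ - u < 12 * M%:Z.
      by apply: int_sqr_lt; first (clear; lia);
        move: m2 mM hv MM; rewrite !expr2; move: (u) (v) => u' v'; clear; lia.
    rewrite /u /v in u1 u2 v1 v2; clear -u1 u2 v1 v2 ks hn.
    by do !split; lia.
  have H k : (M <= k /\ M + k <= 2 * n)%N ->
      eqX M (E * gauss_binomial ('X^3 : {poly int}) (2 * n) k) 1.
    move=> [Mk kM]; apply: eqX_trans (@gauss_binomial_eqX 3 (2 * n) k M isT Mk kM).
    by apply: eqXM => //; apply: (@qpoch_eqX 3 N M).
  case: bd => b0 b1 b2; rewrite -[X in eqX _ _ X]mulr1; apply: eqXM; last exact: H.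
  by rewrite -[X in eqX _ _ X]mulr1; apply: eqXM; exact: H.
rewrite -exprD -['X^_]scale1r; apply: supportedZXn => _; exists m; split => //.
move: m2; set u := (6 * _ + _ + 1); set v := (3 * (k2%:Z - n%:Z) + 1) => m2.
exists (absz u), (absz v); rewrite -!mulnn; clear -m2.
have : u ^+ 2 = (absz u * absz u)%N%:Z by rewrite -abszM -expr2 gez0_abs ?sqr_ge0.
have : v ^+ 2 = (absz v * absz v)%N%:Z by rewrite -abszM -expr2 gez0_abs ?sqr_ge0.
by move=> hv hu; rewrite hu hv in m2; move: m2; lia.
Qed.

(** By core_identity the central Gauss binomial, which is 1 / (X; X) modulo
    'X^M, times the cube of (X^3; X^3) is a sum of terms X^m with m as
    claimed. *)
Lemma core3_supported M N p : (M <= N)%N ->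
  eqX M (qpoch 'X N * p) (qpoch 'X^3 N ^+ 3) -> supported M eisenstein_norm p.
Proof.
move=> MN hp; have [n hn] : exists n, (7 * M + 7 <= n)%N by exists (7 * M + 7)%N.
pose U := gauss_binomial ('X : {poly int}) (6 * n) (3 * n) * qpoch 'X^3 N ^+ 3.
have sU : supported ('C(3 * n, 2) + M)
    (fun m => exists m', m = ('C(3 * n, 2) + m')%N /\ eisenstein_norm m')
    ('X^('C(3 * n, 2)) * U).
  rewrite mulrA core_identity mulrC coefM mulr_sumr; apply: supported_sum => i _.
  rewrite coefM mulr_suml mulr_sumr; apply: supported_sum => l _.
  rewrite !coef_poly.
  have nul : supported ('C(3 * n, 2) + M)
      (fun m => exists m', m = ('C(3 * n, 2) + m')%N /\ eisenstein_norm m') 0.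
    by move=> m _; rewrite coef0 eqxx.
  case: ltnP => k0; last by rewrite !mul0r mulr0.
  case: ltnP => k1; last by rewrite mulr0 mul0r mulr0.
  case: ltnP => k2; last by rewrite !mulr0.
  apply: core_term => //.
  by have := ltn_ord i; have := ltn_ord l; clear; lia.
have {}sU : supported M eisenstein_norm U.
  move=> m mM Um; have [||m' [/eqP]] := sU ('C(3 * n, 2) + m)%N; first by rewrite ltn_add2l.
    by rewrite coefXnM ltnNge leq_addr /= addKn.
  by rewrite eqn_add2l => /eqP->.
apply: supported_eqX sU; apply: (@eqX_cancel _ (qpoch 'X N)); first exact: (@qpoch_coef0 1).
apply: eqX_trans hp _; rewrite mulrA -[X in eqX _ X _]mul1r; apply: eqXM => //.
have Mn : (M <= 3 * n)%N by clear -hn; lia.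
have Mn' : (M + 3 * n <= 6 * n)%N by clear -hn; lia.
apply: eqX_sym; apply: eqX_trans (@gauss_binomial_eqX 1 (6 * n) (3 * n) M isT Mn Mn').
by apply: eqXM => //; apply: (@qpoch_eqX 1).
Qed.
End ThreeCores.

(** * Evaluation in the unit disc *)

Section Evaluation.
Local Open Scope classical_set_scope.
Local Open Scope complex_scope.
Local Open Scope ring_scope.
Variable R : realType.
Implicit Types (p : {poly int}) (P : nat -> {poly int}) (q : R[i]).

(** P N determines a formal power series modulo 'X^N. *)
Definition coherent P := forall M N N', (M <= N)%N -> (M <= N')%N -> eqX M (P N) (P N').

(** (absp p).[r] is the l^1 norm of p with weights r^i, a submultiplicative
    norm. *)
Definition absp p : {poly R} := \poly_(i < size p) (`|p`_i|%:~R).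

Definition bounded_in_disc P :=
  forall r : R, 0 <= r < 1 -> exists B : R, forall N, (absp (P N)).[r] <= B.

Definition ev p q : R[i] := (map_poly intr p).[q].

Lemma coef_absp p i : (absp p)`_i = `|p`_i|%:~R.
Proof.
by rewrite coef_poly; case: ltnP => // h; rewrite nth_default.
Qed.

Lemma le_horner (f g : {poly R}) r : 0 <= r -> (forall i, f`_i <= g`_i) -> f.[r] <= g.[r].
Proof.
move=> r0 fg; rewrite (horner_coef_wide _ (leq_maxl (size f) (size g))).
rewrite (horner_coef_wide _ (leq_maxr (size f) (size g))).
by apply: ler_sum => i _; rewrite ler_wpM2r // exprn_ge0.
Qed.

Lemma absp_ge0 p r : 0 <= r -> 0 <= (absp p).[r].
Proof.
move=> r0; rewrite horner_coef; apply: sumr_ge0 => i _.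
by rewrite mulr_ge0 ?exprn_ge0 // coef_absp ler0z.
Qed.

Lemma abspM p p' r : 0 <= r -> (absp (p * p')).[r] <= (absp p).[r] * (absp p').[r].
Proof.
move=> r0; rewrite -hornerM; apply: le_horner => // i.
rewrite coef_absp !coefM.
have -> : \sum_(j < i.+1) (absp p)`_j * (absp p')`_(i - j) =
    (\sum_(j < i.+1) `|p`_j * p'`_(i - j)|)%:~R.
  by rewrite rmorph_sum; apply: eq_bigr => j _; rewrite !coef_absp normrM rmorphM.
by rewrite ler_int ler_norm_sum.
Qed.

Lemma abspD p p' r : 0 <= r -> (absp (p + p')).[r] <= (absp p).[r] + (absp p').[r].
Proof.
move=> r0; rewrite -hornerD; apply: le_horner => // i.
by rewrite coefD !coef_absp coefD -rmorphD ler_int ler_normD.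
Qed.

Lemma absp_Xn k r : (absp 'X^k).[r] = r ^+ k.
Proof.
rewrite (_ : absp _ = 'X^k) ?hornerXn //; apply/polyP => i.
by rewrite coef_absp !coefXn; case: (i == k); rewrite ?normr1 ?normr0.
Qed.

Lemma abspN p r : (absp (- p)).[r] = (absp p).[r].
Proof. by congr (_.[r]); apply/polyP => i; rewrite !coef_absp coefN normrN. Qed.

Lemma absp1 r : (absp 1).[r] = 1.
Proof. exact: (absp_Xn 0). Qed.

Lemma coherentM P P' : coherent P -> coherent P' -> coherent (fun N => P N * P' N).
Proof. by move=> h h' M N N' MN MN'; apply: eqXM; [apply: h | apply: h']. Qed.

Lemma boundedM P P' : bounded_in_disc P -> bounded_in_disc P' ->
  bounded_in_disc (fun N => P N * P' N).
Proof.
move=> h h' r r01; have [B hB] := h r r01; have [B' hB'] := h' r r01.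
have /andP[r0 _] := r01; exists (B * B') => N; apply: le_trans (abspM _ _ r0) _.
by apply: ler_pM; rewrite ?absp_ge0.
Qed.

Lemma coherentX P k : coherent P -> coherent (fun N => P N ^+ k).
Proof. by move=> h M N N' MN MN'; apply: eqX_exp; apply: h. Qed.

Lemma boundedX P k : bounded_in_disc P -> bounded_in_disc (fun N => P N ^+ k).
Proof.
move=> h; elim: k => [|k IH].
  by move=> r r01; exists 1 => N; rewrite expr0 absp1.
have := boundedM h IH; congr bounded_in_disc; apply/funext => N.
by rewrite exprS.
Qed.

Lemma evM p p' q : ev (p * p') q = ev p q * ev p' q.
Proof. by rewrite /ev rmorphM hornerM. Qed.

Lemma evX p k q : ev (p ^+ k) q = ev p q ^+ k.
Proof. by rewrite /ev rmorphXn horner_exp. Qed.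

Lemma normc_sum (I : Type) (s : seq I) (F : I -> R[i]) :
  normc (\sum_(i <- s) F i) <= \sum_(i <- s) normc (F i).
Proof.
elim: s => [|i s IH]; first by rewrite !big_nil normc0.
by rewrite !big_cons (le_trans (le_normcD _ _)) // lerD2l.
Qed.

Lemma normcX q k : normc (q ^+ k) = normc q ^+ k.
Proof. by elim: k => [|k IH]; rewrite ?normc1 // !exprS normcM IH. Qed.

Lemma normc_ge0 q : 0 <= normc q.
Proof. by rewrite /normc; case: q => a b; exact: sqrtr_ge0. Qed.

Lemma normcZ (n : int) : normc (n%:~R : R[i]) = `|n|%:~R.
Proof.
have H (m : nat) : normc (m%:R : R[i]) = m%:R.
  elim: m => [|m IH]; first exact: normc0.
  by rewrite normcMn normc1.
by case: n => n /=; rewrite ?NegzE ?rmorphN /= ?normcN ?normrN H.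
Qed.

Lemma cvg_complexP (u : nat -> R[i]) (l : R[i]) :
  (forall e : R, 0 < e -> \forall n \near \oo, normc (l - u n) < e) ->
  (u n : R[i]^o) @[n --> \oo] --> (l : R[i]^o).
Proof.
move=> h; apply/cvgrPdist_lt => e; rewrite ltcE => /andP[/eqP /= ie re].
have := h _ re; apply: filterS => n hn.
have -> : e = (complex.Re e)%:C by apply/eqP; rewrite eq_complex /= ie !eqxx.
by rewrite -[X in X < _]/((normc (l - u n))%:C) ltcR.
Qed.

Lemma normc_ReIm (z : R[i]) : normc z <= `|complex.Re z| + `|complex.Im z|.
Proof.
case: z => a b /=; rewrite -[leRHS]ger0_norm ?addr_ge0 // -sqrtr_sqr.
rewrite ler_wsqrtr // sqrrD !real_normK ?num_real // lerD2r lerDl.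
by rewrite mulrn_wge0 // mulr_ge0.
Qed.

Lemma normc_Re (z : R[i]) : `|complex.Re z| <= normc z.
Proof. by rewrite -lecR; exact: normc_ge_Re. Qed.

Lemma normc_Im (z : R[i]) : `|complex.Im z| <= normc z.
Proof.
case: z => a b /=; rewrite -sqrtr_sqr ler_wsqrtr // lerDr sqr_ge0 //.
Qed.

(** The stable coefficients g satisfy sum |g_n| rho^n < oo for rho = |q|, so the
    real and imaginary parts of the series converge absolutely. For rho < r < 1
    the terms of P_N(q) beyond N have modulus sum at most (rho / r)^N times the
    norm of P_N at r, which is bounded. *)
Theorem coherent_family_cvg P q : coherent P -> bounded_in_disc P -> normc q < 1 ->
  exists l : R[i], ((ev (P N) q : R[i]^o) @[N --> \oo] --> (l : R[i]^o)) /\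
   (series (fun n => ((P n.+1)`_n)%:~R * q ^+ n : R[i]^o) @ \oo --> (l : R[i]^o)).
Proof.
move=> cP bP q1; pose rho := normc q; have rho0 : 0 <= rho := normc_ge0 q.
pose g n := (P n.+1)`_n.
have gE n N : (n < N)%N -> (P N)`_n = g n.
  by move=> nN; apply: (cP n.+1).
pose u n : R[i] := (g n)%:~R * q ^+ n.
pose v n : R := `|g n|%:~R * rho ^+ n.
have v0 n : 0 <= v n by rewrite mulr_ge0 ?exprn_ge0 // ler0z.
have nu n : normc (u n) = v n by rewrite /u normcM normcZ normcX.
have cv : cvgn (series v).
  apply: nondecreasing_is_cvgn.
    by apply/nondecreasing_seqP => n; rewrite /series /= big_nat_recr //= lerDl.
  have [|B hB] := bP rho; first by rewrite rho0.
  exists B => _ [n _ <-]; apply: le_trans (hB n).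
  rewrite (horner_coef_wide _ (leq_maxr n (size (absp (P n))))) -(big_mkord xpredT
     (fun i => (absp (P n))`_i * rho ^+ i)) (big_cat_nat (n := n)) ?leq_maxl //=.
  rewrite ler_wpDr //.
    by apply: sumr_ge0 => i _; rewrite coef_absp mulr_ge0 ?exprn_ge0 // ler0z.
  rewrite /series /= big_nat [leRHS]big_nat; apply: ler_sum => i /andP[_ ilt].
  by rewrite coef_absp gE.
have [a ca] : exists a : R, series (fun n => complex.Re (u n)) @ \oo --> a.
  apply/cvg_ex; apply: normed_cvg.
  apply: (series_le_cvg _ v0 _ cv) => n; first exact: normr_ge0.
  by rewrite -nu; exact: normc_Re.
have [b cb] : exists b : R, series (fun n => complex.Im (u n)) @ \oo --> b.
  apply/cvg_ex; apply: normed_cvg.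
  apply: (series_le_cvg _ v0 _ cv) => n; first exact: normr_ge0.
  by rewrite -nu; exact: normc_Im.
have ReS n : complex.Re (series u n) = series (fun n => complex.Re (u n)) n.
  by rewrite /series /= raddf_sum.
have ImS n : complex.Im (series u n) = series (fun n => complex.Im (u n)) n.
  by rewrite /series /= raddf_sum.
pose l : R[i] := (a +i* b)%C.
have near_l e : 0 < e -> \forall n \near \oo, normc (l - series u n) < e.
  move=> e0; have e2 : 0 < e / 2 by rewrite divr_gt0.
  have /cvgrPdist_lt/(_ _ e2) ha := ca; have /cvgrPdist_lt/(_ _ e2) hb := cb.
  near=> n; apply: le_lt_trans (normc_ReIm _) _; rewrite !raddfB /= ReS ImS.
  rewrite [ltRHS]splitr; apply: ltrD; near: n; [exact: ha | exact: hb].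
exists l; split; last exact: cvg_complexP.
apply: cvg_complexP => e e0; have e2 : 0 < e / 2 by rewrite divr_gt0.
pose r := (1 + rho) / 2.
have {}q1 : rho < 1 := q1.
have r01 : 0 <= r < 1 by apply/andP; split; rewrite /r; lra.
have rr : rho < r by rewrite /r; lra.
have r0 : 0 < r by rewrite /r; lra.
have [B hB] := bP r r01.
have B0 : 0 <= B by apply: le_trans (hB 0%N); apply: absp_ge0; rewrite ltW.
have tail N : normc (ev (P N) q - series u N) <= B * (rho / r) ^+ N.
  pose K := maxn N (size (P N)).
  have -> : ev (P N) q = \sum_(0 <= i < K) ((P N)`_i)%:~R * q ^+ i.
    rewrite /ev (@horner_coef_wide _ K) ?big_mkord.
      by apply: eq_bigr => i _; rewrite coef_map.
    by apply: leq_trans (size_poly _ _) (leq_maxr _ _).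
  rewrite (big_cat_nat (n := N)) ?leq_maxl //= addrC.
  have -> : \sum_(0 <= i < N) ((P N)`_i)%:~R * q ^+ i = series u N.
    by rewrite /series /= big_nat [RHS]big_nat; apply: eq_bigr => i /andP[_ iN]; rewrite gE.
  rewrite addrK; apply: le_trans (normc_sum _ _) _.
  apply: le_trans (_ : \sum_(N <= i < K) (rho / r) ^+ N * ((absp (P N))`_i * r ^+ i) <= _).
    rewrite big_nat [leRHS]big_nat; apply: ler_sum => i /andP[Ni _].
    rewrite normcM normcZ normcX coef_absp mulrCA ler_wpM2l ?ler0z //.
    rewrite -(subnKC Ni) !exprD mulrA -exprMn divfK ?gt_eqF // ler_wpM2l ?exprn_ge0 //.
    by apply: lerXn2r; rewrite ?nnegrE ?normc_ge0 //; exact: ltW.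
  rewrite -mulr_sumr mulrC; apply: ler_wpM2r; first by rewrite exprn_ge0 // divr_ge0 // ltW.
  apply: le_trans (hB N).
  rewrite (@horner_coef_wide _ K); last by apply: leq_trans (size_poly _ _) (leq_maxr _ _).
  rewrite -(big_mkord xpredT (fun i => (absp (P N))`_i * r ^+ i)).
  rewrite [leRHS](big_cat_nat (n := N)) ?leq_maxl //=; apply: ler_wpDl => //.
  by apply: sumr_ge0 => i _; rewrite coef_absp mulr_ge0 ?exprn_ge0 ?ler0z // ltW.
have small : \forall n \near \oo, B * (rho / r) ^+ n < e / 2.
  have : (B * (rho / r) ^+ n) @[n --> \oo] --> B * 0.
    apply: cvgM; first exact: cvg_cst.
    apply: cvg_expr; rewrite ger0_norm; first by rewrite ltr_pdivrMr // mul1r.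
    by rewrite divr_ge0 // ltW.
  rewrite mulr0 => /cvgrPdist_lt/(_ _ e2); apply: filterS => n.
  by rewrite sub0r normrN; apply: le_lt_trans; exact: ler_norm.
near=> N.
have -> : l - ev (P N) q = (l - series u N) - (ev (P N) q - series u N).
  by rewrite opprB addrA subrK.
apply: le_lt_trans (le_normcD _ _) _; rewrite normcN [ltRHS]splitr.
apply: ltrD; first by near: N; exact: near_l.
by apply: le_lt_trans (tail N) _; near: N.
Unshelve. all: by end_near.
Qed.
End Evaluation.

(** * The eta quotient as a family of polynomials *)

Section InverseProduct.
Local Open Scope ring_scope.

(** Truncated geometric series make the inverse of prod (1 - X^i) a polynomial
    modulo 'X^N. *)
Definition euler_inverse N : {poly int} :=
  \prod_(1 <= i < N.+1) \sum_(j < N.+1) 'X^i ^+ j.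

Lemma euler_inverseE N : eqX N (qpoch 'X N * euler_inverse N) 1.
Proof.
rewrite /qpoch /euler_inverse -big_split /=.
rewrite (eq_bigr (fun i => 1 - ('X^i) ^+ N.+1 : {poly int})); last first.
  by move=> i _; rewrite -[RHS]opprB subrX1 -mulNr opprB.
rewrite [X in eqX _ _ X](_ : 1 = \prod_(1 <= i < N.+1) (1 : {poly int})); last by rewrite big1.
rewrite big_nat [X in eqX _ _ X]big_nat; apply: eqX_prod => i /andP[i1 _] m mN.
rewrite coefB -exprM coefXn; case: eqP => [mE|_]; last by rewrite subr0.
by clear -i1 mN mE; nia.
Qed.

Lemma qpoch_coherent c : (0 < c)%N -> coherent (qpoch ('X^c : {poly int})).
Proof. by move=> c0 M N N' MN MN'; apply: qpoch_eqX. Qed.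

Lemma euler_inverse_coherent : coherent euler_inverse.
Proof.
move=> M N N' MN MN'; apply: (@eqX_cancel _ (qpoch 'X N)); first exact: (@qpoch_coef0 1).
apply: (@eqX_trans _ 1); first (apply: (eqX_le MN); exact: euler_inverseE).
apply: eqX_sym; apply: (@eqX_trans _ (qpoch 'X N' * euler_inverse N')).
  by apply: eqXM => //; apply: (@qpoch_coherent 1).
by apply: (eqX_le MN'); exact: euler_inverseE.
Qed.
End InverseProduct.

Section Bounds.
Local Open Scope classical_set_scope.
Local Open Scope complex_scope.
Local Open Scope ring_scope.
Variable R : realType.

Lemma geometric_bound (r : R) n : 0 <= r < 1 -> \sum_(i < n) r ^+ i <= (1 - r)^-1.
Proof.
move=> /andP[r0 r1]; rewrite -[leRHS]mul1r ler_pdivlMr ?subr_gt0 // mulrC.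
by rewrite -opprB mulNr -subrX1 opprB gerBl exprn_ge0.
Qed.

(** Use 1 + x <= exp x and the geometric series. *)
Lemma absp_prod_le (f : nat -> {poly int}) N (r K : R) : 0 <= r < 1 -> 0 <= K ->
  (forall i, (0 < i)%N -> (absp R (f i)).[r] <= 1 + K * r ^+ i) ->
  (absp R (\prod_(1 <= i < N.+1) f i)).[r] <= expR (K * (1 - r)^-1).
Proof.
move=> r01 K0 hf; have /andP[r0 r1] := r01.
apply: le_trans (_ : expR (K * \sum_(i < N.+1) r ^+ i) <= _); last first.
  by rewrite ler_expR ler_wpM2l // geometric_bound.
elim: N => [|N IH].
  rewrite big_geq // absp1 big_ord1 expr0 mulr1 -expR0 ler_expR //.
rewrite big_nat_recr //= big_ord_recr /= mulrDr expRD.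
apply: le_trans (abspM _ _ r0) _; apply: ler_pM => //; try exact: absp_ge0.
exact: le_trans (hf _ _) (expR_ge1Dx _).
Qed.

Lemma qpoch_bounded c : (0 < c)%N -> bounded_in_disc R (qpoch 'X^c).
Proof.
move=> c0 r r01; have /andP[r0 r1] := r01.
exists (expR (1 * (1 - r)^-1)) => N; apply: absp_prod_le => // i _.
apply: le_trans (abspD _ _ r0) _; rewrite abspN absp1 -exprM absp_Xn mul1r lerD2l.
rewrite -[leRHS]mul1r mulnC exprM; case: c c0 => // c _.
rewrite exprSr ler_wpM2r ?exprn_ge0 // exprn_ile1 ?exprn_ge0 //.
by rewrite exprn_ile1 // ltW.
Qed.

Lemma absp_sum (I : Type) (s : seq I) (F : I -> {poly int}) (r : R) : 0 <= r ->
  (absp R (\sum_(i <- s) F i)).[r] <= \sum_(i <- s) (absp R (F i)).[r].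
Proof.
move=> r0; elim: s => [|i s IH].
  rewrite !big_nil horner_coef big1 // => i _; by rewrite coef_absp coef0 normr0 mul0r.
by rewrite !big_cons (le_trans (abspD _ _ r0)) // lerD2l.
Qed.

Lemma euler_inverse_bounded : bounded_in_disc R euler_inverse.
Proof.
move=> r r01; have /andP[r0 r1] := r01.
exists (expR ((1 - r)^-1 * (1 - r)^-1)) => N.
apply: absp_prod_le => // [|i i0]; first by rewrite invr_ge0 subr_ge0 ltW.
apply: le_trans (absp_sum _ _ r0) _.
rewrite big_ord_recl expr0 absp1 lerD2l.
have ri0 : 0 <= r ^+ i by rewrite exprn_ge0.
have rir : r ^+ i <= r.
  by case: i i0 {ri0} => // i _; rewrite exprS ler_piMr // exprn_ile1 // ltW.
apply: le_trans (_ : \sum_(j < N) r ^+ i * (r ^+ i) ^+ j <= _).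
  by apply: ler_sum => j _; rewrite -exprM absp_Xn exprM exprS.
rewrite -mulr_sumr mulrC ler_wpM2r //.
apply: le_trans (geometric_bound _ _) _; first by rewrite ri0 (le_lt_trans rir).
by rewrite lef_pV2 ?posrE ?subr_gt0 ?(le_lt_trans rir) // lerD2l lerN2.
Qed.

Lemma ev_qpoch c N (w : R[i]) :
  ev (qpoch 'X^c N) w = \prod_(1 <= n < N.+1) (1 - (w ^+ c) ^+ n).
Proof.
rewrite /ev /qpoch rmorph_prod horner_prod; apply: eq_bigr => i _.
by rewrite -!exprM rmorphB rmorph1 /= map_polyXn hornerD hornerN (hornerC 1) hornerXn.
Qed.

Definition euler_product (w : R[i]) : R[i] :=
  lim ((\prod_(1 <= n < N.+1) (1 - w ^+ n) : R[i]^o) @[N --> \oo]).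

Lemma euler_product_cvg c (w : R[i]) : (0 < c)%N -> normc w < 1 ->
  (ev (qpoch 'X^c N) w : R[i]^o) @[N --> \oo] --> (euler_product (w ^+ c) : R[i]^o).
Proof.
move=> c0 w1.
have [l [cl _]] := coherent_family_cvg (qpoch_coherent c0) (qpoch_bounded c0) w1.
suff -> : euler_product (w ^+ c) = l by [].
apply: (@cvg_lim (R[i]^o) (@norm_hausdorff _ (R[i]^o))).
by under eq_fun do rewrite -ev_qpoch.
Qed.

Definition eta_quotient_family a b c N : {poly int} :=
  qpoch 'X^a N ^+ a * qpoch 'X^(a * c) N ^+ (b - a) * euler_inverse N.

Lemma eta_quotient_coherent a b c : (0 < a)%N -> (0 < c)%N ->
  coherent (eta_quotient_family a b c).
Proof.
move=> a0 c0; apply: coherentM; last exact: euler_inverse_coherent.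
by apply: coherentM; apply: coherentX; apply: qpoch_coherent; rewrite ?muln_gt0 ?a0.
Qed.

Lemma eta_quotient_bounded a b c : (0 < a)%N -> (0 < c)%N ->
  bounded_in_disc R (eta_quotient_family a b c).
Proof.
move=> a0 c0; apply: boundedM; last exact: euler_inverse_bounded.
by apply: boundedM; apply: boundedX; apply: qpoch_bounded; rewrite ?muln_gt0 ?a0.
Qed.

(** The families for the product and its inverse multiply to 1 as formal series,
    hence so do their limits; this is also why the product does not vanish. *)
Lemma euler_inverse_cvg (w : R[i]) : normc w < 1 ->
  euler_product w != 0 /\
  (ev (euler_inverse N) w : R[i]^o) @[N --> \oo] --> ((euler_product w)^-1 : R[i]^o).
Proof.
move=> w1.
have [l [cl _]] := coherent_family_cvg euler_inverse_coherent euler_inverse_bounded w1.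
have cE := @euler_product_cvg 1 w isT w1; rewrite [w ^+ 1]expr1 in cE.
have cP := coherentM (@qpoch_coherent 1 isT) euler_inverse_coherent.
have bP := boundedM (@qpoch_bounded 1 isT) euler_inverse_bounded.
have [l1 [c1 s1]] := coherent_family_cvg cP bP w1.
have coefE n : (qpoch 'X^1 n.+1 * euler_inverse n.+1)`_n = (n == 0)%:R.
  by rewrite -coef1; exact: (@euler_inverseE n.+1 n (ltnSn n)).
have l1E : l1 = 1.
  have hs : series (fun n =>
      (((qpoch 'X^1 n.+1 * euler_inverse n.+1)`_n)%:~R * w ^+ n : R[i]^o)) @ \oo --> (1 : R[i]^o).
    rewrite -(cvg_shiftn 1) (_ : (fun n => _) = (fun=> 1 : R[i]^o)); first exact: cvg_cst.
    apply/funext => n; rewrite /series /= addn1 big_nat_recl //= big1_seq.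
      by rewrite coefE eqxx expr0 mulr1 addr0.
    by move=> i _; rewrite coefE mul0r.
  exact: (cvg_unique (@norm_hausdorff _ (R[i]^o)) s1 hs).
have prod : euler_product w * l = 1.
  have h : (ev (qpoch 'X^1 N * euler_inverse N) w : R[i]^o) @[N --> \oo] -->
      (euler_product w * l : R[i]^o).
    by under eq_fun do rewrite evM; exact: (cvgM cE cl).
  by rewrite -l1E; exact: (cvg_unique (@norm_hausdorff _ (R[i]^o)) h c1).
have nz : euler_product w != 0.
  by apply: contra_eq_neq prod => ->; rewrite mul0r eq_sym oner_eq0.
split; first exact: nz.
have le : (euler_product w)^-1 = l by apply: (mulfI nz); rewrite prod divff.
by rewrite le.
Qed.

Lemma cvg_expn (K : numFieldType) (u : nat -> K) (x : K) k :
  u n @[n --> \oo] --> x -> (u n ^+ k) @[n --> \oo] --> x ^+ k.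
Proof.
move=> ux; elim: k => [|k IH]; first exact: cvg_cst.
by rewrite exprS; under eq_fun do rewrite exprS; exact: cvgM.
Qed.

Lemma eta_quotient_cvg a b c (w : R[i]) : (0 < a)%N -> (0 < c)%N -> normc w < 1 ->
  series (fun n => ((eta_quotient_family a b c n.+1)`_n)%:~R * w ^+ n : R[i]^o) @ \oo -->
   (euler_product (w ^+ a) ^+ a * euler_product (w ^+ (a * c)) ^+ (b - a) / euler_product w : R[i]^o).
Proof.
move=> a0 c0 w1.
have [l [cl sl]] := coherent_family_cvg (@eta_quotient_coherent a b c a0 c0)
  (@eta_quotient_bounded a b c a0 c0) w1.
suff <- : l = euler_product (w ^+ a) ^+ a *
    euler_product (w ^+ (a * c)) ^+ (b - a) / euler_product w by [].
apply: (cvg_unique (@norm_hausdorff _ (R[i]^o)) cl).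
have ac0 : (0 < a * c)%N by rewrite muln_gt0 a0.
rewrite /= /eta_quotient_family; under eq_fun do rewrite !evM !evX.
apply: (@cvgM R[i]); last exact: (euler_inverse_cvg w1).2.
by apply: (@cvgM R[i]); apply: (@cvg_expn R[i]); exact: euler_product_cvg.
Qed.
End Bounds.

(** * The q-expansion of the eta quotient *)

Section Nome.
Local Open Scope classical_set_scope.
Local Open Scope complex_scope.
Local Open Scope ring_scope.
Variable R : realType.
Implicit Types z : R[i].

Lemma cexpD z z' : cexp (z + z') = cexp z * cexp z'.
Proof.
case: z => a b; case: z' => a' b'; rewrite /cexp /= expRD cosD sinD.
by apply/eqP; rewrite eq_complex /=; apply/andP; split; apply/eqP; ring.
Qed.

Lemma cexp0 : cexp 0 = 1 :> R[i].
Proof. by rewrite /cexp /= expR0 cos0 sin0 mulr1 mulr0. Qed.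

Lemma nome_natM k z : nome (k%:R * z) = nome z ^+ k.
Proof.
elim: k => [|k IH]; first by rewrite /nome mul0r mulr0 cexp0.
by rewrite exprS -IH -natr1 mulrDl mul1r /nome [X in cexp X]mulrDr cexpD mulrC.
Qed.

Lemma normc_nome z : normc (nome z) = expR (- (2 * pi * complex.Im z)).
Proof.
case: z => x y; rewrite /nome /cexp /=.
rewrite !exprMn -mulrDr cos2Dsin2 mulr1 sqrtr_sqr ger0_norm ?expR_ge0 //.
congr expR; ring.
Qed.

Lemma normc_nome_lt1 z : 0 < complex.Im z -> normc (nome z) < 1.
Proof.
move=> z0; rewrite normc_nome -expR0 ltr_expR oppr_lt0 mulr_gt0 // mulr_gt0 //.
exact: pi_gt0.
Qed.

Lemma nome_neq0 z : nome z != 0.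
Proof.
apply/eqP => z0; have := normc_nome z; rewrite z0 normc0 => /esym/eqP.
by rewrite gt_eqF // expR_gt0.
Qed.

(** The arguments of the three eta functions are 24 k z, so the fractional power
    of the nome becomes a natural power. *)
Lemma dedekind_etaE k z : dedekind_eta ((24 * k)%:R * z) =
  nome z ^+ k * euler_product ((nome z ^+ 24) ^+ k).
Proof.
rewrite /dedekind_eta.
have -> : nome ((24 * k)%:R * z / 24%:R) = nome z ^+ k.
  by rewrite -nome_natM natrM; congr nome; field.
by have -> : nome ((24 * k)%:R * z) = (nome z ^+ 24) ^+ k by rewrite nome_natM exprM.
Qed.

Lemma etaFE a b c z : (0 < a)%N -> (a <= b)%N -> (0 < c)%N ->
  let w := nome z ^+ 24 in
  etaF a b c z = nome z ^+ (a * a + a * c * (b - a) - 1) *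
   (euler_product (w ^+ a) ^+ a * euler_product (w ^+ (a * c)) ^+ (b - a) / euler_product w).
Proof.
move=> a0 ab c0 w; rewrite /etaF subzn // -exprnP -mulnA !dedekind_etaE.
have -> : dedekind_eta (24%:R * z) = nome z * euler_product w.
  by rewrite -[24%N]muln1 dedekind_etaE !expr1.
rewrite -/w !exprMn -!exprM invfM.
set s := (a * a + a * c * (b - a) - 1)%N.
have sE : (a * a + a * c * (b - a) = s.+1)%N.
  by rewrite /s subn1 prednK // addn_gt0 muln_gt0 a0.
have : nome z ^+ (a * a) * nome z ^+ (a * c * (b - a)) = nome z * nome z ^+ s.
  by rewrite -exprD sE exprS.
have nz := nome_neq0 z.
move: (nome z ^+ (a * a)) (nome z ^+ (a * c * (b - a))) => x y xy.
have -> : nome z ^+ s = x * y / nome z by rewrite xy mulrC mulKf.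
ring.
Qed.

(** The coefficients of q^r G(q^24), where G has coefficients g. *)
Definition spread_coefficient (g : nat -> int) r n : R[i] :=
  if (r <= n)%N && (24 %| n - r)%N then (g ((n - r) %/ 24)%N)%:~R else 0.

(** Only one exponent in 24 occurs, so the partial sums are those of G at a
    ceiling. *)
Lemma series_spread g r (q : R[i]) n :
  series (fun n => spread_coefficient g r n * q ^+ n) n =
  q ^+ r * series (fun m => (g m)%:~R * (q ^+ 24) ^+ m) (ceil_div (n - r) 24).
Proof.
have zero k : (k < r)%N -> spread_coefficient g r k * q ^+ k = 0.
  by move=> kr; rewrite /spread_coefficient leqNgt kr mul0r.
rewrite /series /=; have [rn|nr] := leqP r n; last first.
  have -> : (n - r = 0)%N by apply/eqP; rewrite subn_eq0 ltnW.
  rewrite [X in _ * X]big_geq // mulr0 big_nat big1 // => k /andP[_ kn].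
  by apply: zero; apply: ltn_trans nr.
rewrite (big_cat_nat (n := r)) //= big_nat big1 ?add0r; last by move=> k /andP[_ /zero].
rewrite -{1}[r]add0n big_addn mulr_sumr.
transitivity (\sum_(0 <= k < n - r | (24 %| k)%N) (g (k %/ 24)%N)%:~R * q ^+ (k + r)).
  rewrite [RHS]big_mkcond; apply: eq_bigr => k _; rewrite /spread_coefficient.
  by rewrite leq_addl addnK /=; case: ifP => _; rewrite ?mul0r.
rewrite sum_multiples //; apply: eq_bigr => k _.
by rewrite mulKn // exprD exprM mulrA mulrC.
Qed.

Lemma etaF_q_expansion a b c : (0 < a)%N -> (a <= b)%N -> (0 < c)%N ->
  q_expansion (@etaF R a b c)
   (spread_coefficient (fun m => (eta_quotient_family a b c m.+1)`_m)
      (a * a + a * c * (b - a) - 1)).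
Proof.
move=> a0 ab c0 z z0; rewrite etaFE //; set r := (_ - 1)%N.
have w1 : normc (nome z ^+ 24) < 1.
  by rewrite normcX exprn_ilt1 // ?normc_ge0 // normc_nome_lt1.
have h := @eta_quotient_cvg R a b c _ a0 c0 w1.
rewrite (_ : series _ = (fun n => nome z ^+ r *
   series (fun m => ((eta_quotient_family a b c m.+1)`_m)%:~R * (nome z ^+ 24) ^+ m)
     (ceil_div (n - r) 24))); last by apply/funext => n; exact: series_spread.
apply: (@cvgM R[i]); first exact: cvg_cst.
apply: (cvg_comp (fun n => ceil_div (n - r) 24) _ _ h).
apply/cvgnyPge => A; near=> n.
rewrite /ceil_div leq_divRL //.
have : (A * 24 + r <= n)%N by near: n; exact: nbhs_infty_ge.
lia.
Unshelve. all: by end_near.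
Qed.
End Nome.

(** * Exponents in the five cases *)

Section Exponents.
Local Open Scope ring_scope.

Lemma qpoch_comp_Xn c N : qpoch ('X^c : {poly int}) N = qpoch 'X N \Po 'X^c.
Proof.
rewrite /qpoch (rmorph_prod (comp_poly _)); apply: eq_bigr => i _.
by rewrite rmorphB rmorph1 /= comp_Xn_poly.
Qed.

Lemma euler_supported_Xn c M N : (0 < c)%N -> (M <= N)%N ->
  supported M (fun m => exists i, m = (c * i)%N /\ pentagonal i) (qpoch ('X^c : {poly int}) N).
Proof.
move=> c0 MN; rewrite qpoch_comp_Xn; apply: supported_comp_Xn => //; exact: euler_supported.
Qed.

Lemma jacobi_supported_Xn c M N : (0 < c)%N -> (M <= N)%N ->
  supported M (fun m => exists i, m = (c * i)%N /\ triangular i) (qpoch ('X^c : {poly int}) N ^+ 3).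
Proof.
move=> c0 MN; rewrite qpoch_comp_Xn -(rmorphXn (comp_poly _)).
apply: supported_comp_Xn => //; exact: jacobi_supported.
Qed.

Lemma eta_quotient_cancel b c N :
  eqX N (eta_quotient_family 1 b c N) (qpoch 'X^c N ^+ (b - 1)).
Proof.
rewrite /eta_quotient_family mul1n -[X in eqX _ _ X]mulr1 expr1 mulrAC mulrC.
by apply: eqXM => //; exact: euler_inverseE.
Qed.

Lemma eta_square_quotient_supported N :
  supported N triangular (qpoch 'X^2 N ^+ 2 * euler_inverse N).
Proof.
apply: (@gauss_supported N N) => //; rewrite mulrCA -[X in eqX _ _ X]mulr1.
by apply: eqXM => //; exact: euler_inverseE.
Qed.

Lemma eta_cube_quotient_supported N :
  supported N eisenstein_norm (qpoch 'X^3 N ^+ 3 * euler_inverse N).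
Proof.
apply: (@core3_supported N N) => //; rewrite mulrCA -[X in eqX _ _ X]mulr1.
by apply: eqXM => //; exact: euler_inverseE.
Qed.

Definition binary_form_exponents (f : nat -> int) r :=
  exists A B, [/\ (0 < A)%N, (0 < B)%N &
    forall m, f m != 0 -> exists x y, (24 * m + r = A * x ^ 2 + B * y ^ 2)%N].

(** Complete the square in each of the two theta series; the exponent r is what
    this needs: for example 24 (c i + c j) + 2 c = c (24 i + 1) + c (24 j + 1). *)
Lemma eta_quotient_exponents a b c : (0 < c)%N ->
  (b = 3 /\ (a = 1 \/ a = 2 \/ a = 3) \/ b = 5 /\ (a = 1 \/ a = 2))%N ->
  binary_form_exponents (fun m => (eta_quotient_family a b c m.+1)`_m)
    (a * a + a * c * (b - a) - 1).
Proof.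
move=> c0; have c2 : (0 < 2 * c)%N by rewrite muln_gt0.
case=> [[-> [->|[->|->]]]|[-> [->|->]]].
- exists c, c; split=> // m nz.
  have e := @euler_supported_Xn c m.+1 m.+1 c0 (leqnn _).
  have := supportedM e e; rewrite -expr2.
  move=> /(supported_eqX (@eta_quotient_cancel 3 c m.+1))
    /(_ m (ltnSn m) nz)[_ [_ [-> [i [-> [x xi]]] [j [-> [y yj]]]]]].
  by exists x, y; rewrite -xi -yj; lia.
- exists 3, (2 * c)%N; split=> // m nz.
  have e := @euler_supported_Xn (2 * c) m.+1 m.+1 c2 (leqnn _).
  have := supportedM (@eta_square_quotient_supported m.+1) e; rewrite mulrAC -[X in _ * X * _]expr1.
  move=> /(_ m (ltnSn m) nz)[i [_ [-> [x xi] [j [-> [y yj]]]]]].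
  by exists x, y; rewrite -xi -yj; lia.
- exists 2, 6; split=> // m nz.
  have : supported m.+1 eisenstein_norm (eta_quotient_family 3 3 c m.+1).
    by rewrite /eta_quotient_family expr0 mulr1; exact: eta_cube_quotient_supported.
  move=> /(_ m (ltnSn m) nz)[x [y xy]].
  by exists x, y; lia.
- exists c, (3 * c)%N; split=> //; first by rewrite muln_gt0.
  move=> m nz.
  have e := @euler_supported_Xn c m.+1 m.+1 c0 (leqnn _).
  have := supportedM e (@jacobi_supported_Xn c m.+1 m.+1 c0 (leqnn _)); rewrite -exprS.
  move=> /(supported_eqX (@eta_quotient_cancel 5 c m.+1))
    /(_ m (ltnSn m) nz)[_ [_ [-> [i [-> [x xi]]] [j [-> [y yj]]]]]].
  by exists x, y; rewrite -mulnA -xi -yj; lia.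
- exists 3, (6 * c)%N; split=> //; first by rewrite muln_gt0.
  move=> m nz.
  have e := @jacobi_supported_Xn (2 * c) m.+1 m.+1 c2 (leqnn _).
  have := supportedM (@eta_square_quotient_supported m.+1) e; rewrite mulrAC.
  move=> /(_ m (ltnSn m) nz)[i [_ [-> [x xi] [j [-> [y yj]]]]]].
  by exists x, y; rewrite -xi -yj; lia.
Qed.
End Exponents.

(** * Lacunarity *)

Section Lacunarity.
Local Open Scope classical_set_scope.
Local Open Scope ring_scope.
Variable R : realType.

Lemma card_zeros_below (u : nat -> R[i]) (x : R) : 0 < x ->
  #|` fset_set [set n : nat | n%:R < x /\ u n = 0]| =
  count (fun n => u n == 0) (iota 0 `|Num.ceil x|).
Proof.
move=> x0.
have ltE n : (n%:R < x) = (n < `|Num.ceil x|)%N.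
  have c0 : 0 < Num.ceil x by rewrite ceil_gt0.
  by rewrite -[n%:R]/(n%:Z%:~R) -ceil_gt_int -ltz_nat gez0_abs // ltW.
have fS : finite_set [set n : nat | n%:R < x /\ u n = 0].
  apply: (sub_finite_set _ (finite_II `|Num.ceil x|)) => n /= [nx _].
  by rewrite -ltE.
have -> : fset_set [set n : nat | n%:R < x /\ u n = 0] =
    [fset n in [seq n <- iota 0 `|Num.ceil x| | u n == 0]]%fset.
  apply/fsetP => n; rewrite in_fset_set // !inE /= mem_filter mem_iota add0n.
  apply/idP/idP => [/set_mem /= [nx ->]|/andP[/eqP un nx]].
    by rewrite eqxx -ltE.
  by apply/mem_set; rewrite /= ltE un.
by rewrite card_fseq undup_id ?filter_uniq ?iota_uniq // size_filter.
Qed.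

(** Multiplication by A maps the support injectively into the values of
    x^2 + A B y^2, and (A x)^2 + A B y^2 = A (A x^2 + B y^2). *)
Lemma lacunary_of_binary_form (u : nat -> R[i]) A B : (0 < A)%N -> (0 < B)%N ->
  (forall n, u n != 0 -> exists x y, (n = A * x ^ 2 + B * y ^ 2)%N) ->
  lacunary_series u.
Proof.
move=> A0 B0 hu; apply/cvgrPdist_le => e e0.
have D0 : (0 < A * B)%N by rewrite muln_gt0 A0.
have A0R : 0 < A%:R :> R by rewrite ltr0n.
have [N0 hN0] := @values_density_zero R (A * B) (e / A%:R) D0 (divr_gt0 e0 A0R).
have nonzeros N : (N0 <= N)%N -> (count (fun n => u n != 0) (iota 0 N))%:R <= e * N%:R :> R.
  move=> N0N; have : (N0 <= A * N)%N by apply: leq_trans N0N _; rewrite leq_pmull.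
  move=> /hN0; have -> : e / A%:R * (A * N)%:R = e * N%:R.
    by rewrite natrM; field; rewrite gt_eqF.
  apply: le_trans; rewrite ler_nat -size_filter -(size_map (muln A)) -[X in (_ <= X)%N]size_filter.
  apply: uniq_leq_size.
    rewrite map_inj_uniq ?filter_uniq ?iota_uniq // => i j /eqP.
    by rewrite eqn_pmul2l // => /eqP.
  move=> k /mapP[n]; rewrite mem_filter mem_iota add0n => /andP[/hu[x [y nE]] /= nN] ->.
  rewrite mem_filter mem_iota add0n ltn_pmul2l // nN !andbT.
  by apply/is_valueP => //; exists (A * x)%N, y; rewrite nE expnMn; lia.
near=> x.
have x0 : 0 < x by near: x; apply: nbhs_pinfty_gt; rewrite num_real.
have xe : e^-1 < x by near: x; apply: nbhs_pinfty_gt; rewrite num_real.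
have xN : N0%:R < x by near: x; apply: nbhs_pinfty_gt; rewrite num_real.
rewrite card_zeros_below //.
set N := `|Num.ceil x|%N.
have NE : N%:R = (Num.ceil x)%:~R :> R.
  by rewrite -[N%:R]/(N%:Z%:~R) /N gez0_abs // ceil_ge0 (lt_trans _ x0) // ltrN10.
have /andP[c1 c2] := ceil_itv x; rewrite intrB -NE in c1 c2.
have N0N : (N0 <= N)%N by rewrite -(ler_nat R) (le_trans (ltW xN)).
have := nonzeros N N0N.
have : N%:R = (count (fun n => u n == 0) (iota 0 N))%:R + (count (fun n => u n != 0) (iota 0 N))%:R :> R.
  rewrite -natrD; congr (_%:R); rewrite -{1}(size_iota 0 N).
  exact/esym/(count_predC (fun n => u n == 0)).
have z0 : 0 <= (count (fun n => u n == 0) (iota 0 N))%:R :> R by [].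
have nz0 : 0 <= (count (fun n => u n != 0) (iota 0 N))%:R :> R by [].
move: (count (fun n => u n == 0) _)%:R z0 (count (fun n => u n != 0) _)%:R nz0 (N%:R) c1 c2.
move=> z z0 nz nz0 M c1 c2 zE nzE.
have e1 : 1 < e * x by rewrite mulrC -ltr_pdivrMr // mul1r.
have xx : x / x = 1 by rewrite divff // gt_eqF.
rewrite ler_norml; apply/andP; split.
  rewrite -lerN2 opprK opprB lerBlDr ler_pdivrMr //; lra.
rewrite lerBlDr -lerBlDl ler_pdivlMr //; have [e1'|e1'] := leP e 1.
  have : 0 <= (1 - e) * (M - x) by rewrite mulr_ge0 // subr_ge0.
  lra.
have : 0 <= (e - 1) * x by rewrite mulr_ge0 ?ltW // subr_gt0.
lra.
Unshelve. all: by end_near.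
Qed.

Lemma eta_quotient_lacunary a b c : (0 < c)%N ->
  (b = 3 /\ (a = 1 \/ a = 2 \/ a = 3) \/ b = 5 /\ (a = 1 \/ a = 2))%N ->
  lacunary_in_q (@etaF R a b c).
Proof.
move=> c0 h; have [a0 ab] : (0 < a)%N /\ (a <= b)%N by lia.
exists (spread_coefficient R (fun m => (eta_quotient_family a b c m.+1)`_m)
      (a * a + a * c * (b - a) - 1)).
split; first exact: etaF_q_expansion.
have [A [B [A0 B0 hAB]]] := eta_quotient_exponents c0 h.
apply: (lacunary_of_binary_form A0 B0) => n; rewrite /spread_coefficient.
case: ifP => [/andP[rn d24]|_]; last by rewrite eqxx.
rewrite intr_eq0 => /hAB[x [y xy]]; exists x, y; rewrite -xy.
by rewrite mulnC divnK // subnK.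
Qed.
End Lacunarity.

Theorem theorem1p1 (R : realType) (a b : nat)
    (ha : (1 <= a)%N) (hb : (1 <= b)%N) (hbodd : odd b) :
  (b = 3 -> (a = 1 \/ a = 2 \/ a = 3) ->
     forall c : nat, (1 <= c)%N -> lacunary_in_q (@etaF R a b c)) /\
  (b = 5 -> (a = 1 \/ a = 2) ->
     forall c : nat, (1 <= c)%N -> lacunary_in_q (@etaF R a b c)).
Proof.
by split=> hb' ha' c c0; apply: eta_quotient_lacunary => //; [left | right].
Qed.
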